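(* Assume $\texttt{NP}\neq\texttt{co-NP}$ and assume the following conjecture holds: for every graph $G$ and every $m\in\mathbb{N}_{>0}$, $\text{ffn}(G)>m$ if and only if there exist a subgraph $G'=(V',E')$ of $G$ and an $i\in[|V'|-m]$ such that every $W\subseteq V'$ with $|W|=i$ has at least $m$ neighbours in $G'$. Then for every constant $c\in\mathbb{N}$, the decision problem FireFighting restricted to graphs of treewidth at most $c$ is not NP-hard.
   Context: All graphs are finite, simple and undirected. For a graph $G=(V,E)$ and $W\subseteq V$, $N(W)$ is the set of nodes in $V\setminus W$ adjacent to at least one node of $W$ (the neighbours of $W$). For $m\in\mathbb{N}_{>0}$, an $m$-strategy of length $T$ is a sequence $(F_1,\dots,F_T)$ of subsets of $V$ with $|F_i|\le m$. Its burning sets are $B_0=V$ and $B_t=(B_{t-1}\setminus F_t)\cup N(B_{t-1}\setminus F_t)$ for $t\ge1$, where $F_t=\emptyset$ for $t>T$. The strategy is winning if $B_T=\emptyset$. $\text{ffn}(G)$ is the smallest $m$ admitting a winning $m$-strategy. FireFighting: given $G$ and $m\in\mathbb{N}_{>0}$, decide whether $\text{ffn}(G)\le m$. $[n]=\{1,\dots,n\}$. *)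

(* Defs.v *)
From HB Require Import structures.
From mathcomp Require Import all_boot all_order all_algebra.
From mathcomp Require Import boolp.

Set Implicit Arguments.
Unset Strict Implicit.
Unset Printing Implicit Defensive.

Record sgraph := SGraph {
  vertex :> finType;
  adj : rel vertex;
  adj_sym : symmetric adj;
  adj_irr : irreflexive adj }.

Definition neighbours (T : finType) (e : rel T) (W : {set T}) : {set T} :=
  [set y | (y \notin W) && [exists x in W, e x y]].

(* Not necessarily induced.  Edges have both ends in [sub_vertices], so
   [neighbours (sub_adj H) W] is the neighbourhood of W inside H. *)
Record subgraph (G : sgraph) := Subgraph {
  sub_vertices : {set G};
  sub_adj : rel G;
  sub_adj_sym : symmetric sub_adj;
  sub_adjP : forall x y, sub_adj x y ->
    [&& adj x y, x \in sub_vertices & y \in sub_vertices] }.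

Definition is_tree (T : sgraph) : Prop :=
  [/\ 0 < #|T|,
      forall x y : T, connect (@adj T) x y
    & forall s : seq T, 2 < size s -> ~ ucycle (@adj T) s].

Definition tree_decomposition (G T : sgraph) (bag : T -> {set G}) : Prop :=
  [/\ is_tree T,
      forall v : G, exists t, v \in bag t,
      forall u v : G, adj u v -> exists t, (u \in bag t) && (v \in bag t)
    & forall (v : G) (t1 t2 : T), v \in bag t1 -> v \in bag t2 ->
        connect [rel a b | [&& adj a b, v \in bag a & v \in bag b]] t1 t2].

(* The empty graph gets width 0 instead of -1. *)
Definition width (G T : sgraph) (bag : T -> {set G}) : nat :=
  (\max_(t : T) #|bag t|).-1.

Definition has_width (G : sgraph) (k : nat) : Prop :=
  exists (T : sgraph) (bag : T -> {set G}),
    tree_decomposition bag /\ width bag = k.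

Lemma ex_has_width (G : sgraph) : exists k, `[< has_width G k >].
Proof.
have sy : symmetric (fun _ _ : unit => false) by [].
have ir : irreflexive (fun _ _ : unit => false) by [].
pose bag (_ : SGraph sy ir) := [set: G].
exists (width bag); apply/asboolP; exists (SGraph sy ir), bag; split=> //; split.
- split; first by rewrite card_unit.
    by move=> [] []; apply: connect0.
  by move=> [|[] [|[] s]] // _ /andP[].
- by move=> v; exists tt; rewrite inE.
- by move=> u v _; exists tt; rewrite !inE.
- by move=> v [] [] _ _; apply: connect0.
Qed.

Definition treewidth (G : sgraph) : nat := ex_minn (ex_has_width G).

Definition strategy (G : sgraph) (m : nat) (F : seq {set G}) : bool :=
  all (fun A : {set G} => #|A| <= m) F.

(* F = [:: F_1; ...; F_T], so F_(t+1) is [nth set0 F t]. *)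
Fixpoint burning (G : sgraph) (F : seq {set G}) (t : nat) : {set G} :=
  if t is t'.+1 then
    let R := burning F t' :\: nth set0 F t' in R :|: neighbours (@adj G) R
  else [set: G].

Definition winning (G : sgraph) (F : seq {set G}) : bool :=
  burning F (size F) == set0.

(* m = 0 is excluded, so the empty graph has firefighting number 1. *)
Definition winnable (G : sgraph) (m : nat) : Prop :=
  0 < m /\ exists F : seq {set G}, strategy m F /\ winning F.

Lemma ex_winnable (G : sgraph) : exists m, `[< winnable G m >].
Proof.
exists #|G|.+1; apply/asboolP; split=> //; exists [:: [set: G]]; split.
  by rewrite /strategy /= cardsT leqnSn.
rewrite /winning /= setDT set0U; apply/eqP/setP=> y; rewrite !inE /=.
by apply/existsP=> -[x]; rewrite inE.
Qed.

Definition ffn (G : sgraph) : nat := ex_minn (ex_winnable G).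

Definition expansion_conjecture : Prop :=
  forall (G : sgraph) (m : nat), 0 < m ->
    m < ffn G <->
    exists (H : subgraph G) (i : nat),
      [/\ 0 < i, i <= #|sub_vertices H| - m
        & forall W : {set G}, W \subset sub_vertices H -> #|W| = i ->
            m <= #|neighbours (sub_adj H) W|].

(* [None] is the blank; [inl] are the input/output bits, [inr] the work
   symbols of the machine. *)
Definition cell (A : Type) := option (bool + A).
Definition bit (A : Type) (b : bool) : cell A := Some (inl b).

Inductive move := MoveL | Stay | MoveR.

(* A two-way infinite tape; [tleft] is listed from the head outwards, and all
   the cells that are not listed are blank. *)
Record tape (A : Type) := Tape {
  tleft : seq (cell A);
  thead : cell A;
  tright : seq (cell A) }.

Definition tape_of (A : Type) (s : seq (cell A)) : tape A :=
  Tape [::] (head None s) (behead s).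

Definition tape_act (A : Type) (a : cell A * move) (t : tape A) : tape A :=
  match a.2 with
  | MoveL => Tape (behead (tleft t)) (head None (tleft t)) (a.1 :: tright t)
  | Stay => Tape (tleft t) a.1 (tright t)
  | MoveR => Tape (a.1 :: tleft t) (head None (tright t)) (behead (tright t))
  end.

Record machine := Machine {
  extra_tapes : nat;
  symbol : finType;
  state : finType;
  start : state;
  final : pred state;
  trans : state -> {ffun 'I_extra_tapes.+2 -> cell symbol} ->
          state * {ffun 'I_extra_tapes.+2 -> cell symbol * move} }.

Record config (M : machine) := Config {
  cstate : state M;
  ctapes : {ffun 'I_(extra_tapes M).+2 -> tape (symbol M)} }.

Definition step (M : machine) (c : config M) : config M :=
  if final (cstate c) then c else
  let r := trans (cstate c) [ffun i => thead (ctapes c i)] in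
  Config r.1 [ffun i => tape_act (r.2 i) (ctapes c i)].

Definition init (M : machine) (x w : seq bool) : config M :=
  Config (start M)
    [ffun i : 'I_(extra_tapes M).+2 =>
       tape_of (map (@bit (symbol M)) (nth [::] [:: x; w] i))].

Fixpoint read_bits (A : Type) (s : seq (cell A)) : seq bool :=
  if s is Some (inl b) :: s' then b :: read_bits s' else [::].

(* The output is the word on tape 0 that starts at the head. *)
Definition output (M : machine) (c : config M) : seq bool :=
  let t := ctapes c ord0 in read_bits (thead t :: tright t).

Definition computes_in (M : machine) (x w : seq bool) (t : nat) (y : seq bool)
    : Prop :=
  let c := iter t (@step M) (init M x w) in final (cstate c) /\ output c = y.

Definition language := seq bool -> Prop.

Definition polytime (f : seq bool -> seq bool) : Prop :=
  exists (M : machine) (p : {poly nat}),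
    forall x, computes_in M x [::] p.[size x]%R (f x).

Definition polytime_rel (V : seq bool -> seq bool -> bool) : Prop :=
  exists (M : machine) (p : {poly nat}),
    forall x w, computes_in M x w p.[(size x + size w)%N]%R [:: V x w].

Definition NP (L : language) : Prop :=
  exists (V : seq bool -> seq bool -> bool) (q : {poly nat}),
    polytime_rel V /\
    forall x, L x <-> exists w, size w <= q.[size x]%R /\ V x w.

Definition coNP (L : language) : Prop := NP (fun x => ~ L x).

Record problem := Problem {
  instance : Type;
  encode : instance -> seq bool;
  yes : instance -> Prop }.

Definition restrict (P : problem) (Q : instance P -> Prop) : problem :=
  @Problem {i : instance P | Q i} (fun i => encode (sval i))
    (fun i => yes (sval i)).

(* Many-one (Karp) reduction.  Every output must be the code of an instance of
   P; when P is a restricted problem, of an instance in the restriction. *)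
Definition reduces_to (L : language) (P : problem) : Prop :=
  exists f : seq bool -> seq bool, polytime f /\
    forall x, exists i : instance P, f x = encode i /\ (L x <-> yes i).

Definition NP_hard (P : problem) : Prop :=
  forall L : language, NP L -> reduces_to L P.

Record ff_instance := FFInstance {
  ff_graph : sgraph;
  ff_num : nat;
  ff_num_gt0 : 0 < ff_num }.

(* Binary, least significant bit first. *)
Fixpoint bits_of_pos (p : BinNums.positive) : seq bool :=
  match p with
  | BinNums.xH => [:: true]
  | BinNums.xO p' => false :: bits_of_pos p'
  | BinNums.xI p' => true :: bits_of_pos p'
  end.

Definition bits_of_nat (n : nat) : seq bool :=
  if bin_of_nat n is BinNums.Npos p then bits_of_pos p else [::].

(* 1^n 0, the n * n adjacency matrix row by row, then m in binary, where n is
   the number of vertices. *)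
Definition ff_encode (I : ff_instance) : seq bool :=
  nseq #|ff_graph I| true ++
  false :: [seq adj x y | x <- enum (ff_graph I), y <- enum (ff_graph I)] ++
  bits_of_nat (ff_num I).

Definition FireFighting : problem :=
  @Problem ff_instance ff_encode (fun I => ffn (ff_graph I) <= ff_num I).

(* Main.v *)
From mathcomp Require Import all_boot all_order all_algebra.
From mathcomp Require Import boolp zify.
Require Import Defs.

Set Implicit Arguments.
Unset Strict Implicit.
Unset Printing Implicit Defensive.

(** NP-hardness of the restricted problem would put every NP language L into
coNP: by the conjecture, a no-instance is witnessed by a set A of vertices and
a number i such that all i-subsets W of A have at least m neighbours inside A,
and for bounded treewidth this universal statement has a short proof.

The proof is a derivation of judgements.  Its lines label every vertex as
undecided, chosen (in W), rejected, or forgotten, and carry two counters: how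
many vertices remain to be chosen and how many neighbours are still required.
A line is justified by deciding an undecided vertex both ways, by counting a
rejected vertex that has a chosen neighbour, or by forgetting a vertex.
Recursively splitting A at a bag of the tree decomposition that is a centroid
gives an order of A in which, at any moment, only O(c log n) decided vertices
still have undecided neighbours; hence n^O(c) lines suffice.

Whether a word encodes such a derivation is a first-order property of the pair
(instance, word), with quantifiers ranging over positions, and first-order
properties are decided by nested loops over unary counters, which a multitape
machine runs in polynomial time after the reduction. *)

(** * Stack programs and their machines *)

(** The pair (A, i) alone would not do as a certificate, because the claim about all i-subsets of A
    is itself universal; hence the derivation. The verifier never sees a tree decomposition: the
    rules are sound in every graph, and treewidth matters only for the existence of a derivation of
    polynomial length. No order on the lines has to be verified either, since every rule lowers the
    label of one vertex, so premises cannot lead back to their conclusion.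

    The exponent arises as follows: each centroid bag costs at most c + 1 live vertices on each of
    about log |A| levels, and a line is determined by a position in the order and two subsets of a
    set of that size, up to one more vertex.

    Polynomial time refers to concrete multitape machines, so the machine work is done once, for all
    formulas. What a first-order formula over positions does not express directly, such as comparing
    a cardinality with a number or decoding a binary numeral, is guessed in further tables of the
    certificate and checked locally. *)

Definition upd (T : Type) (e : nat -> T) (r : nat) (v : T) : nat -> T :=
  fun j => if j == r then v else e j.

Definition store := nat -> seq bool.

Inductive prog :=
  | Skip
  | Push of nat & bool
  | Pop of nat
  | Seq of prog & prog
  | If of nat & prog & prog & prog
  | While of nat & prog.

Definition branch (T : Type) (s : seq bool) (t f n : T) : T :=
  match s with true :: _ => t | false :: _ => f | [::] => n end.

(** The number is a time budget for the compiled control. [Push] costs 2 because the head first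
    moves left and then writes; each test costs 1. *)
Inductive exec : prog -> store -> nat -> store -> Prop :=
  | ExSkip e : exec Skip e 1 e
  | ExPush e r b : exec (Push r b) e 2 (upd e r (b :: e r))
  | ExPop e r : exec (Pop r) e 1 (upd e r (behead (e r)))
  | ExSeq P Q e1 e2 e3 t1 t2 : exec P e1 t1 e2 -> exec Q e2 t2 e3 ->
      exec (Seq P Q) e1 (t1 + t2) e3
  | ExIf r P Q R e t e' : exec (branch (e r) P Q R) e t e' ->
      exec (If r P Q R) e t.+1 e'
  | ExWhileNil r P e : e r = [::] -> exec (While r P) e 1 e
  | ExWhile r P e1 e2 e3 t1 t2 : e1 r <> [::] -> exec P e1 t1 e2 ->
      exec (While r P) e2 t2 e3 -> exec (While r P) e1 (t1 + t2).+1 e3.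

Fixpoint regs_below (k : nat) (P : prog) : bool :=
  match P with
  | Skip => true
  | Push r _ | Pop r => r < k
  | Seq P Q => regs_below k P && regs_below k Q
  | If r P Q R =>
      [&& r < k, regs_below k P, regs_below k Q & regs_below k R]
  | While r P => (r < k) && regs_below k P
  end.

Lemma regs_belowW k k' P : k <= k' -> regs_below k P -> regs_below k' P.
Proof.
move=> le_kk'; elim: P => //=.
- by move=> r _ /leq_trans; apply.
- by move=> r /leq_trans; apply.
- by move=> P IHP Q IHQ /andP[/IHP-> /IHQ->].
- by move=> r P IHP Q IHQ R IHR /and4P[/leq_trans-> // /IHP-> /IHQ-> /IHR->].
- by move=> r P IHP /andP[/leq_trans-> // /IHP->].
Qed.

Fixpoint reg_bound (P : prog) : nat :=
  match P with
  | Skip => 0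
  | Push r _ | Pop r => r.+1
  | Seq P Q => maxn (reg_bound P) (reg_bound Q)
  | If r P Q R =>
      maxn r.+1 (maxn (reg_bound P) (maxn (reg_bound Q) (reg_bound R)))
  | While r P => maxn r.+1 (reg_bound P)
  end.

Lemma regs_below_bound P : regs_below (reg_bound P) P.
Proof.
elim: P => //=.
- by move=> P IHP Q IHQ; rewrite !(regs_belowW _ IHP, regs_belowW _ IHQ) //; lia.
- move=> r P IHP Q IHQ R IHR.
  rewrite (regs_belowW _ IHP) ?(regs_belowW _ IHQ) ?(regs_belowW _ IHR) ?andbT; lia.
- by move=> r P IHP; rewrite (regs_belowW _ IHP) ?andbT; lia.
Qed.

(* The stack held by a tape is its maximal word of bits from the head rightwards;
   what lies beyond is irrelevant garbage. *)
Definition content (A : Type) (t : tape A) : seq bool :=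
  read_bits (thead t :: tright t).

Lemma content_push (A : Type) (t : tape A) b :
  content (tape_act (bit A b, Stay) (tape_act (thead t, MoveL) t)) =
  b :: content t.
Proof. by []. Qed.

Lemma content_pop (A : Type) (t : tape A) c b : thead t = bit A b ->
  content (tape_act (c, MoveR) t) = behead (content t).
Proof. by case: t => l h [|a r] /= ->. Qed.

Lemma tape_act_id (A : Type) (t : tape A) : tape_act (thead t, Stay) t = t.
Proof. by case: t. Qed.

(** * Compiling stack programs into the control of a machine *)

Section Fragments.

Variables (k : nat) (A : finType).
Let tapes := {ffun 'I_k.+1 -> tape A}.
Let reads := {ffun 'I_k.+1 -> cell A}.
Let acts := {ffun 'I_k.+1 -> cell A * move}.

Definition heads (s : tapes) : reads := [ffun i => thead (s i)].
Definition act_all (a : acts) (s : tapes) : tapes :=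
  [ffun i => tape_act (a i) (s i)].

(** [None] is the exit of a fragment; the surrounding fragment decides where control continues. *)
Definition frag (Q : Type) := Q -> reads -> option Q * acts.

Definition frag_step (Q : Type) (d : frag Q) (c : option Q * tapes) :=
  if c.1 is Some q then
    let r := d q (heads c.2) in (r.1, act_all r.2 c.2)
  else c.

Lemma iter_frag_Some (Q : Type) (d : frag Q) t q s :
  iter t.+1 (frag_step d) (Some q, s) =
  iter t (frag_step d) ((d q (heads s)).1, act_all (d q (heads s)).2 s).
Proof. by rewrite iterSr. Qed.

Lemma iter_frag_None (Q : Type) (d : frag Q) t s :
  iter t (frag_step d) (None, s) = (None, s).
Proof. by elim: t => //= t ->. Qed.

(** Only t' <= t is available: the inner run may already idle in [None] for some of its t steps,
    while the outer control has moved on. *)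
Lemma frag_embed (Q Q' : Type) (d : frag Q) (d' : frag Q') (f : Q -> Q')
    (o : option Q') :
  (forall q rd, d' (f q) rd =
     (if (d q rd).1 is Some q1 then Some (f q1) else o, (d q rd).2)) ->
  forall t q s s', iter t (frag_step d) (Some q, s) = (None, s') ->
  exists2 t', t' <= t & iter t' (frag_step d') (Some (f q), s) = (o, s').
Proof.
move=> d'E; elim=> [|t IHt] q s s' //; rewrite iter_frag_Some.
case E: (d q (heads s)) => [[q1|] a] /=.
  case/IHt=> t' le_t't def_t'; exists t'.+1 => //.
  by rewrite iter_frag_Some d'E E.
rewrite iter_frag_None => -[<-]; exists 1 => //.
by rewrite iter_frag_Some d'E E.
Qed.

Definition act_at (r : nat) (rd : reads) (a : cell A * move) : acts :=
  [ffun i => if val i == r then a else (rd i, Stay)].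

(** Program counters. [Push] has two because it takes two machine steps; the added [None] of [If]
    and [While] is the moment of the test. *)
Fixpoint pos (P : prog) : finType :=
  match P with
  | Skip | Pop _ => unit
  | Push _ _ => bool
  | Seq P Q => (pos P + pos Q)%type
  | If _ P Q R => option (pos P + (pos Q + pos R))
  | While _ P => option (pos P)
  end.

Fixpoint entry (P : prog) : pos P :=
  match P with
  | Skip | Pop _ => tt
  | Push _ _ => false
  | Seq P Q => inl (entry P)
  | If _ _ _ _ | While _ _ => None
  end.

Definition stay (rd : reads) : acts := [ffun i => (rd i, Stay)].

Definition to_bits (c : cell A) : seq bool :=
  if c is Some (inl b) then [:: b] else [::].

Fixpoint control (P : prog) : frag (pos P) :=
  match P return frag (pos P) with
  | Skip => fun _ rd => (None, stay rd)
  | Push r b => fun q rd =>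
      if q then (None, act_at r rd (bit A b, Stay))
      else (Some true, act_at r rd (rd (inord r), MoveL))
  (* A head without a bit means an empty stack; moving right there could uncover garbage bits, so
     the tape is left alone. *)
  | Pop r => fun _ rd =>
      (None, if to_bits (rd (inord r)) is [::] then stay rd
             else act_at r rd (None, MoveR))
  | Seq P Q => fun q rd =>
      match q with
      | inl p => let c := control p rd in
          (Some (if c.1 is Some p' then inl p' else inr (entry Q)), c.2)
      | inr p => let c := control p rd in (omap inr c.1, c.2)
      end
  | If r P Q R => fun q rd =>
      match q with
      | None =>
          (Some (Some (branch (to_bits (rd (inord r))) (inl (entry P))
             (inr (inl (entry Q))) (inr (inr (entry R))))), stay rd)
      | Some (inl p) =>
          let c := control p rd in (omap (fun p => Some (inl p)) c.1, c.2)
      | Some (inr (inl p)) =>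
          let c := control p rd in (omap (fun p => Some (inr (inl p))) c.1, c.2)
      | Some (inr (inr p)) =>
          let c := control p rd in (omap (fun p => Some (inr (inr p))) c.1, c.2)
      end
  | While r P => fun q rd =>
      match q with
      | None =>
          (if to_bits (rd (inord r)) is [::] then None else Some (Some (entry P)),
           stay rd)
      | Some p => let c := control p rd in (Some c.1, c.2)
      end
  end.

Definition holds (s : tapes) (e : store) : Prop :=
  forall i : 'I_k.+1, content (s i) = e i.

Lemma act_all_stay s : act_all (stay (heads s)) s = s.
Proof. by apply/ffunP=> i; rewrite !ffunE tape_act_id. Qed.

Lemma to_bits_head s e r : r < k.+1 -> holds s e ->
  to_bits (heads s (inord r)) = take 1 (e r).
Proof.
move=> lt_rk se; rewrite -{2}(inordK lt_rk) -se ffunE /content.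
by case: (s _) => l [[b|a]|] [|c rt] //=; rewrite take0.
Qed.

Lemma control_correct P e t e' s : exec P e t e' -> regs_below k.+1 P ->
  holds s e ->
  exists2 s', iter t (frag_step (@control P)) (Some (entry P), s) = (None, s')
    & holds s' e'.
Proof.
move=> ex; elim: ex s => {P e t e'}.
- move=> e s _ se; exists s => //=.
  by rewrite /frag_step /= act_all_stay.
- move=> e r b s /= lt_rk se; rewrite /frag_step /=.
  eexists; first reflexivity.
  move=> i; rewrite !ffunE /upd; case: eqP => [ri|_].
    have -> : inord r = i by apply: val_inj; rewrite /= inordK.
    by rewrite ?ffunE ?ri content_push se ?ri.
  by rewrite !tape_act_id se.
- move=> e r s /= lt_rk se; rewrite /frag_step /=.
  eexists; first reflexivity.
  have := to_bits_head lt_rk se; rewrite /upd.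
  case E: (to_bits _) => [|b l] Er; rewrite ?act_all_stay => i.
    by rewrite se; case: eqP => // ->; case: (e r) Er.
  rewrite !ffunE; case: eqP => [ri|_]; last by rewrite tape_act_id se.
  have ir : inord r = i by apply: val_inj; rewrite /= inordK.
  rewrite -ri -se; move: E; rewrite ffunE ir.
  by case E: (thead _) => [[b'|]|] // _; rewrite (content_pop _ E).
- move=> P Q e1 e2 e3 t1 t2 _ IH1 _ IH2 s /= /andP[rP rQ] se.
  have [s1 def1 s1e] := IH1 s rP se; have [s2 def2 s2e] := IH2 s1 rQ s1e.
  exists s2 => //.
  have [| t1' le1 def1'] := @frag_embed _ _ _ (@control (Seq P Q)) inl
     (Some (inr (entry Q))) _ _ _ _ _ def1.
    by move=> q rd /=; case: (control q rd) => [[]].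
  have [| t2' le2 def2'] := @frag_embed _ _ _ (@control (Seq P Q)) inr
     None _ _ _ _ _ def2.
    by move=> q rd /=; case: (control q rd) => [[]].
  (* Budget that the two parts did not use is spent idling in [None]. *)
  have -> : t1 + t2 = (t1 + t2 - t1' - t2') + (t2' + t1') by lia.
  by rewrite !iterD def1' def2' iter_frag_None.
- move=> r P Q R e t e' _ IH s wf se; have /and4P[lt_rk rP rQ rR] := wf.
  have rB : regs_below k.+1 (branch (e r) P Q R) by case: (e r) => [|[] ?].
  have [s' def_s' s'e] := IH s rB se; exists s' => //.
  rewrite iter_frag_Some /= act_all_stay (to_bits_head lt_rk se).
  suff [t' le_t't def_t'] : exists2 t', t' <= t &
      iter t' (frag_step (@control (If r P Q R))) (Some (Some
        (branch (take 1 (e r)) (inl (entry P)) (inr (inl (entry Q)))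
          (inr (inr (entry R))))), s) = (None, s').
    by rewrite -(subnK le_t't) iterD def_t' iter_frag_None.
  case: (e r) {rB IH} def_s' => [|[] l] /= def_s'.
  + apply: (frag_embed (f := fun p => Some (inr (inr p)))) def_s'.
    by move=> q rd /=; case: (control q rd) => [[]].
  + apply: (frag_embed (f := fun p => Some (inl p))) def_s'.
    by move=> q rd /=; case: (control q rd) => [[]].
  + apply: (frag_embed (f := fun p => Some (inr (inl p)))) def_s'.
    by move=> q rd /=; case: (control q rd) => [[]].
- move=> r P e er0 s wf se; have /andP[lt_rk rP] := wf; exists s => //.
  by rewrite /frag_step /= act_all_stay (to_bits_head lt_rk se) er0.
- move=> r P e1 e2 e3 t1 t2 er _ IH1 _ IH2 s wf se.
  have /andP[lt_rk rP] := wf; have [s1 def1 s1e] := IH1 s rP se.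
  have [s2 def2 s2e] := IH2 s1 wf s1e.
  exists s2 => //.
  have [| t1' le1 def1'] := @frag_embed _ _ _ (@control (While r P)) Some
     (Some None) _ _ _ _ _ def1.
    by move=> q rd /=; case: (control q rd) => [[]].
  rewrite iter_frag_Some /= act_all_stay (to_bits_head lt_rk se).
  case: (e1 r) er => // b l _ /=.
  have -> : t1 + t2 = (t1 - t1') + (t2 + t1') by lia.
  by rewrite !iterD def1' def2 iter_frag_None.
Qed.

End Fragments.

Lemma horner_nat_mono (p : {poly nat}) m n : m <= n -> p.[m]%R <= p.[n]%R.
Proof.
move=> le_mn; rewrite !horner_coef.
elim/big_ind2: _ => // [a b c d|i _]; first exact: leq_add.
have expE (k : nat) : (k ^+ i)%R = k ^ i.
  by elim: (nat_of_ord i) => [|j IHj] //; rewrite GRing.exprS expnS IHj.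
rewrite !{}expE; apply: leq_mul => //.
by case: (nat_of_ord i) => // j; rewrite leq_exp2r.
Qed.

Lemma size_read_bits (A : Type) (s : seq (cell A)) : size (read_bits s) <= size s.
Proof. by elim: s => //= -[[b|a]|] s IHs. Qed.

Lemma read_bits_map (A : Type) (s : seq bool) : read_bits (map (@bit A) s) = s.
Proof. by elim: s => //= b s ->. Qed.

Lemma content_tape_of (A : Type) (s : seq bool) :
  content (tape_of (map (@bit A) s)) = s.
Proof. by case: s => //= b s; rewrite /content /= read_bits_map. Qed.

Lemma iter_step_final (M : machine) (c : config M) t :
  final (cstate c) -> iter t (@step M) c = c.
Proof. by move=> fc; elim: t => //= t ->; rewrite /step fc. Qed.

Lemma size_tright_act (A : Type) (a : cell A * move) (t : tape A) :
  size (tright (tape_act a t)) <= (size (tright t)).+1.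
Proof. by case: a t => a [] [l h r] //=; rewrite size_behead; lia. Qed.

Lemma size_tright_iter (M : machine) (c : config M) t i :
  size (tright (ctapes (iter t (@step M) c) i)) <= size (tright (ctapes c i)) + t.
Proof.
elim: t => [|t IHt] /=; first by rewrite addn0.
rewrite addnS {1}/step; case: ifP => _; first exact: leqW.
by rewrite ffunE; apply: leq_trans (size_tright_act _ _) _; rewrite ltnS.
Qed.

Lemma size_output_iter (M : machine) x w t :
  size (output (iter t (@step M) (init M x w))) <= (size x + t).+1.
Proof.
apply: leq_trans (size_read_bits _) _; rewrite /= ltnS.
apply: leq_trans (size_tright_iter _ _ _) _; rewrite leq_add2r ffunE /=.
by rewrite size_behead size_map leq_pred.
Qed.

(** A final configuration of M is a fixed point of [step], whereas the composed machine leaves it at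
    once. The two runs therefore agree exactly up to the first final time. *)
Lemma first_final (M : machine) (c : config M) t :
  final (cstate (iter t (@step M) c)) ->
  exists2 t', t' <= t & final (cstate (iter t' (@step M) c)) /\
    forall u, u < t' -> ~~ final (cstate (iter u (@step M) c)).
Proof.
move=> ft; have ex : exists t, final (cstate (iter t (@step M) c)) by exists t.
exists (ex_minn ex); first by case: ex_minnP => m _ /(_ t ft).
case: ex_minnP => m fm min_m; split=> // u lt_um.
by apply/negP=> /min_m; rewrite leqNgt lt_um.
Qed.

(** * Running a program on the output of a machine *)

Section Compose.

Variables (M : machine) (P : prog).
Let ef := extra_tapes M.
(** The [k.+2] tapes are those of M, one for the witness, and enough further ones for every register
    of P to name a tape. *)
Let k := ef + 1 + reg_bound P.

(* Tape 1 of M must start blank, so it is moved away from the witness tape. *)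
Definition dst (i : 'I_ef.+2) : 'I_k.+2 := inord (if val i == 0 then 0 else i.+1).
Definition src (j : 'I_k.+2) : option 'I_ef.+2 :=
  if val j == 0 then Some ord0 else if val j == 1 then None else insub (val j).-1.

Lemma dst_val i : val (dst i) = if val i == 0 then 0 else i.+1.
Proof. by rewrite /= inordK //; case: ifP; have := ltn_ord i; rewrite /k; lia. Qed.

Lemma srcP j : match src j with
  | Some i => dst i = j
  | None => val j = 1 \/ ef.+2 < val j end.
Proof.
rewrite /src; case: eqP => j0; first by apply: val_inj; rewrite dst_val.
case: eqP => j1; first by left.
case: insubP => [i lt_i iE|]; last by right; lia.
by apply: val_inj; rewrite dst_val; move: iE j0 j1 => /= ->; case: eqP; lia.
Qed.

Lemma dstK i : src (dst i) = Some i.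
Proof.
rewrite /src dst_val; case: (val i =P 0) => [i0|ni0] /=.
  by congr Some; apply: val_inj.
by case: eqP => [[i0]|_]; [case: ni0 | exact: valK].
Qed.

Definition compose_trans (q : state M + option (pos P))
    (rd : {ffun 'I_k.+2 -> cell (symbol M)}) :=
  match q with
  | inl q =>
      if final q then (inr (Some (entry P)), stay rd) else
      let r := trans q [ffun i => rd (dst i)] in
      (inl r.1, [ffun j => if src j is Some i then r.2 i else (rd j, Stay)])
  | inr (Some p) => let c := control p rd in (inr c.1, c.2)
  | inr None => (q, stay rd)
  end.

Definition compose_machine : machine :=
  @Machine k (symbol M) (state M + option (pos P))%type (inl (start M))
    (pred1 (inr None)) compose_trans.

Let MM := compose_machine.

Definition simulates (c : config MM) (c' : config M) (w : seq bool) : Prop :=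
  [/\ cstate c = inl (cstate c'),
      forall i, ctapes c (dst i) = ctapes c' i
    & forall j, src j = None -> ctapes c j = ctapes (init MM [::] w) j].

Lemma simulates_init x w : simulates (init MM x w) (init M x [::]) w.
Proof.
split=> // [i|j].
  rewrite !ffunE dst_val; case: i => [[|[|i]] lt_i] //=.
  by rewrite !nth_nil.
rewrite !ffunE; have := srcP j; case: (src j) => // -[] /= Ej _; first by rewrite Ej.
by move: Ej; case: (nat_of_ord j) => [|[]].
Qed.

Lemma simulates_step c c' w : ~~ final (cstate c') -> simulates c c' w ->
  simulates (step c) (step c') w.
Proof.
move=> nf [Ec Ed Es]; rewrite /step Ec (negPf nf) /= (negPf nf).
have -> : [ffun i => [ffun j => thead (ctapes c j)] (dst i)] =
          [ffun i => thead (ctapes c' i)].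
  by apply/ffunP=> i; rewrite !ffunE Ed.
split=> //= [i|j srcj]; rewrite !ffunE ?dstK ?Ed // srcj tape_act_id.
by rewrite Es // !ffunE.
Qed.

Lemma simulates_iter x w t :
  (forall u, u < t -> ~~ final (cstate (iter u (@step M) (init M x [::])))) ->
  simulates (iter t (@step MM) (init MM x w)) (iter t (@step M) (init M x [::])) w.
Proof.
elim: t => [|t IHt] nf; first exact: simulates_init.
by apply: simulates_step; [apply: nf | apply: IHt => u /leqW; apply: nf].
Qed.

Lemma step_control (c : config MM) o : cstate c = inr o ->
  cstate (step c) = inr (frag_step (@control _ _ P) (o, ctapes c)).1 /\
  ctapes (step c) = (frag_step (@control _ _ P) (o, ctapes c)).2.
Proof.
case: o => [p|] E; rewrite /step E /frag_step //=.
Qed.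

Lemma iter_step_control (c : config MM) o t : cstate c = inr o ->
  cstate (iter t (@step MM) c) =
    inr (iter t (frag_step (@control _ _ P)) (o, ctapes c)).1 /\
  ctapes (iter t (@step MM) c) = (iter t (frag_step (@control _ _ P)) (o, ctapes c)).2.
Proof.
move=> E; elim: t => //= t [IH1 IH2].
by have := step_control IH1; rewrite IH2 -surjective_pairing.
Qed.

(** Registers 2 to [ef.+2] are unconstrained at the start of P, because M leaves its own tapes
    dirty. *)
Lemma compose_computes x w (tM tP : nat) y b :
  computes_in M x [::] tM y ->
  (forall e : store, e 0 = y -> e 1 = w -> (forall j, ef.+2 < j -> e j = [::]) ->
   exists t e', [/\ t <= tP, exec P e t e' & e' 0 = [:: b]]) ->
  forall t, tM + 1 + tP <= t -> computes_in MM x w t [:: b].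
Proof.
move=> [finM outM] runP t le_t.
have [t1 le1 [fin1 nfin1]] := first_final finM.
have {nfin1}[Ec Ed Es] := simulates_iter w nfin1.
have E1 : iter tM (@step M) (init M x [::]) = iter t1 (@step M) (init M x [::]).
  by rewrite -(subnK le1) iterD iter_step_final.
rewrite {}E1 in finM outM.
set c1 := iter t1 (@step M) _ in fin1 Ec Ed Es finM outM.
set c := iter t1 (@step MM) _ in Ec Ed Es.
have def2 : step c = Config (M := MM) (inr (Some (entry P))) (ctapes c).
  rewrite /step Ec /= fin1; congr Config; apply/ffunP=> i.
  by rewrite !ffunE tape_act_id.
pose e : store := fun j => if j < k.+2 then content (ctapes c (inord j)) else [::].
have ce : holds (ctapes c) e by move=> i; rewrite /e ltn_ord inord_val.
have [|||t2 [e' [le2 ex2 e'0]]] := runP e.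
- rewrite -outM /output -Ed /e /=; congr (content (ctapes c _)).
- rewrite /e /= Es ?ffunE ?inordK ?content_tape_of //.
  by rewrite /src /= inordK.
- move=> j lt_j; rewrite /e; case: ifP => // lt_jk.
  rewrite Es ?ffunE ?inordK //=.
    by case: j lt_j {lt_jk} => [|[|j]] //; rewrite /= nth_nil.
  rewrite /src /= inordK // insubF; last by lia.
  by case: j lt_j {lt_jk} => [|[|j]].
have [|s' def_s' s'e'] := control_correct ex2 _ ce.
  by apply: regs_belowW (regs_below_bound P); rewrite /= /k; lia.
have [] := @iter_step_control (step c) (Some (entry P)) t2; first by rewrite def2.
rewrite {2 4}def2 /= def_s' /= => Ec2 Et2.
rewrite /computes_in; have -> : t = (t - t1 - 1 - t2) + (t2 + (1 + t1)) by lia.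
rewrite !iterD -/c iter_step_final /= ?Ec2 //; split=> //.
rewrite /output Et2 -e'0; exact: s'e'.
Qed.

End Compose.

(** [base] is the first register known to be empty. It depends on the number of tapes of the machine
    for f, so the program may depend on it too. *)
Lemma polytime_rel_comp (f : seq bool -> seq bool) (g : seq bool -> seq bool -> bool) :
  polytime f ->
  (forall base, 1 < base -> exists (P : prog) (p : {poly nat}),
     forall y w (e : store), e 0 = y -> e 1 = w ->
     (forall j, base <= j -> e j = [::]) ->
     exists t e', [/\ t <= p.[(size y + size w)%N]%R, exec P e t e'
       & e' 0 = [:: g y w]]) ->
  polytime_rel (fun x w => g (f x) w).
Proof.
move=> [M [p fM]] /(_ (extra_tapes M).+3 isT) [P [q gP]].
(* A machine stopping after p steps on x outputs at most |x| + p + 1 bits; q is evaluated at a bound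
   for the length of this output plus the witness. *)
exists (compose_machine M P), (p + 1 + (q \Po ('X + p + 1)))%R => x w.
apply: (compose_computes (tM := p.[size x]%R) (y := f x)
  (tP := q.[(size (f x) + size w)%N]%R)) => //.
  move=> e e0 e1 ej; apply: gP => // j; exact: ej.
rewrite !(hornerE, horner_comp); apply: leq_add.
  by apply: leq_add => //; apply: horner_nat_mono; lia.
apply: horner_nat_mono.
have [_ <-] := fM x; have := @size_output_iter M x [::] p.[size x]%R.
have := @horner_nat_mono p (size x) (size x + size w) (leq_addr _ _).
rewrite /GRing.add /GRing.one /=.
set a := p.[_]%R; set b := p.[_]%R; set s := size _; lia.
Qed.

Lemma polytime_size (f : seq bool -> seq bool) : polytime f ->
  exists p : {poly nat}, forall x, size (f x) <= p.[size x]%R.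
Proof.
move=> [M [p fM]]; exists ('X + p + 1)%R => x; rewrite !hornerE.
have [_ <-] := fM x; have := @size_output_iter M x [::] p.[size x]%R.
rewrite /GRing.add /GRing.one /=; lia.
Qed.

(** * First-order formulas over two words *)

Definition runs (P : prog) (e : store) (T : nat) (e' : store) : Prop :=
  exists2 t, t <= T & exec P e t e'.

Lemma runs_weak P e T T' e' e'' : runs P e T e' -> T <= T' -> e' = e'' ->
  runs P e T' e''.
Proof. by move=> [t le_t ex] le_T <-; exists t => //; apply: leq_trans le_T. Qed.

Lemma runs_skip e : runs Skip e 1 e.
Proof. by exists 1 => //; constructor. Qed.

Lemma runs_push e r b : runs (Push r b) e 2 (upd e r (b :: e r)).
Proof. by exists 2 => //; constructor. Qed.

Lemma runs_pop e r : runs (Pop r) e 1 (upd e r (behead (e r))).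
Proof. by exists 1 => //; constructor. Qed.

Lemma runs_seq P Q e e1 e2 T1 T2 : runs P e T1 e1 -> runs Q e1 T2 e2 ->
  runs (Seq P Q) e (T1 + T2) e2.
Proof.
move=> [t1 le1 ex1] [t2 le2 ex2]; exists (t1 + t2); first exact: leq_add.
exact: ExSeq ex1 ex2.
Qed.

Lemma runs_if r P Q R e T e' : runs (branch (e r) P Q R) e T e' ->
  runs (If r P Q R) e T.+1 e'.
Proof. by move=> [t le_t ex]; exists t.+1 => //; apply: ExIf. Qed.

(** [f n] is the store with n rounds to go, so the loop register is its own countdown. *)
Lemma runs_while r P (f : nat -> store) N T :
  (forall n, n <= N -> size (f n r) = n) ->
  (forall n, n < N -> runs P (f n.+1) T (f n)) ->
  runs (While r P) (f N) (N * T.+1).+1 (f 0).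
Proof.
elim: N => [|N IHN] szf body.
  by exists 1 => //; apply/ExWhileNil/size0nil/szf.
have [|n lt_n|t2 le2 ex2] := IHN; [by move=> n /leqW/szf| exact/body/leqW|].
have [t1 le1 ex1] := body N (leqnn _).
exists (t1 + t2).+1; first by rewrite mulSn; lia.
by apply: ExWhile ex1 ex2 => fN; have := szf N.+1 (leqnn _); rewrite fN.
Qed.

Lemma updE (T : Type) (e : nat -> T) r s j :
  upd e r s j = if j == r then s else e j.
Proof. by []. Qed.

Ltac upd_tac :=
  rewrite ?/upd; repeat (case: eqP => ?); subst; try done; try lia.
Ltac store_tac := apply: funext => ?; upd_tac.

Definition Move (a c : nat) : prog :=
  If a (Seq (Pop a) (Push c true)) (Seq (Pop a) (Push c false)) Skip.

Lemma runs_move a c e b s : a <> c -> e a = b :: s ->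
  runs (Move a c) e 4 (upd (upd e a s) c (b :: e c)).
Proof.
move=> nac ea; apply: runs_if; rewrite ea.
have ca : (c == a) = false by apply/eqP=> ac; case: nac.
by case: b ea => ea; apply: runs_weak (runs_seq (runs_pop _ _) (runs_push _ _ _)) _ _ => //;
  rewrite updE ca ea.
Qed.

Definition Clear (a : nat) : prog := While a (Pop a).

Lemma runs_clear a e : runs (Clear a) e (size (e a) * 2).+1 (upd e a [::]).
Proof.
have := @runs_while a (Pop a) (fun n => upd e a (drop (size (e a) - n) (e a)))
  (size (e a)) 1.
rewrite subnn drop0 subn0 drop_size.
have -> : upd e a (e a) = e by store_tac.
apply=> [n le_n|n lt_n]; first by rewrite updE eqxx size_drop; lia.
apply: runs_weak (runs_pop _ _) _ _ => //.
rewrite updE eqxx -drop1 drop_drop; have -> : 1 + (size (e a) - n.+1) = size (e a) - n by lia.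
by store_tac.
Qed.

(** Reading a stack destroys it, so the counter passes through the scratch stack s and is restored
    while r is filled. *)
Definition AddCopy (a r s : nat) : prog :=
  Seq (While a (Seq (Pop a) (Push s true)))
      (While s (Seq (Pop s) (Seq (Push a true) (Push r true)))).

Lemma runs_add_copy a r s e N K : a <> r -> a <> s -> r <> s ->
  e a = nseq N true -> e s = [::] -> e r = nseq K true ->
  runs (AddCopy a r s) e (10 * N + 2) (upd e r (nseq (N + K) true)).
Proof.
move=> nar nas nrs ea es er.
have nsa : (s == a) = false by apply/eqP=> sa; case: nas.
have nas' : (a == s) = false by apply/eqP.
have nrs' : (r == s) = false by apply/eqP.
have nra' : (r == a) = false by apply/eqP=> ra; case: nar.
pose f n := upd (upd e a (nseq n true)) s (nseq (N - n) true).
pose g n := upd (upd (upd e a (nseq (N - n) true)) s (nseq n true)) r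
              (nseq (N - n + K) true).
have f1 := @runs_while a (Seq (Pop a) (Push s true)) f N 3.
have g1 := @runs_while s (Seq (Pop s) (Seq (Push a true) (Push r true))) g N 5.
apply: (@runs_weak _ _ ((N * 4).+1 + (N * 6).+1) _ (g 0)); last first.
- by rewrite /g subn0; store_tac.
- by lia.
apply: (runs_seq (e1 := f 0)).
  have -> : e = f N by rewrite /f subnn; store_tac.
  apply: f1 => [n _|n lt_n]; first by rewrite /f !updE nas' eqxx size_nseq.
  apply: runs_weak (runs_seq (runs_pop _ _) (runs_push _ _ _)) _ _ => //.
  rewrite /f !updE nsa nas' !eqxx /=; have -> : N - n = (N - n.+1).+1 by lia.
  by store_tac.
have -> : f 0 = g N by rewrite /f /g subnn subn0; store_tac.
apply: g1 => [n _|n lt_n].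
  by rewrite /g !updE (eq_sym s) nrs' eqxx size_nseq.
apply: runs_weak
  (runs_seq (runs_pop _ _) (runs_seq (runs_push _ _ _) (runs_push _ _ _))) _ _ => //.
rewrite /g !updE (eq_sym s) (eq_sym a r) nrs' nra' nas' !eqxx /=.
have -> : N - n = (N - n.+1).+1 by lia.
by store_tac.
Qed.

(** * Syntax, cost and compilation of formulas *)

Inductive term :=
  | TVar of nat
  | TZero
  | TSucc of term
  | TAdd of term & term
  | TMul of term & term.

(* [FBit false t] and [FBit true t] read position t of the first and of the
   second word; positions beyond the end read as false. *)
Inductive form :=
  | FBit of bool & term
  | FLt of term & term
  | FNot of form
  | FAnd of form & form
  | FEx of nat & form.

Fixpoint tval (v : nat -> nat) (t : term) : nat :=
  match t with
  | TVar x => v x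
  | TZero => 0
  | TSucc t => (tval v t).+1
  | TAdd t u => tval v t + tval v u
  | TMul t u => tval v t * tval v u
  end.

Fixpoint sat (y w : seq bool) (v : nat -> nat) (F : form) : Prop :=
  match F with
  | FBit z t => nth false (if z then w else y) (tval v t)
  | FLt t u => tval v t < tval v u
  | FNot F => ~ sat y w v F
  | FAnd F G => sat y w v F /\ sat y w v G
  | FEx x F => exists2 n, n <= size y + size w & sat y w (upd v x n) F
  end.

Fixpoint tbound (L : nat) (t : term) : nat :=
  match t with
  | TVar x => L
  | TZero => 0
  | TSucc t => (tbound L t).+1
  | TAdd t u => tbound L t + tbound L u
  | TMul t u => tbound L t * tbound L u
  end.

Lemma tval_bound L v t : (forall x, v x <= L) -> tval v t <= tbound L t.
Proof.
move=> vL; elim: t => //= t IHt u IHu; first exact: leq_add.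
exact: leq_mul.
Qed.

Fixpoint tcost (L : nat) (t : term) : nat :=
  match t with
  | TVar x => 10 * L + 2
  | TZero => 1
  | TSucc t => tcost L t + 2
  | TAdd t u => tcost L t + tcost L u + 4 * tbound L u + 1
  | TMul t u => tcost L t + tcost L u + tbound L t * (10 * tbound L u + 4)
                + 2 * tbound L u + 2
  end.

Fixpoint tprog (vr : nat -> nat) (r : nat) (t : term) : prog :=
  match t with
  | TVar x => AddCopy (vr x) r r.+1
  | TZero => Skip
  | TSucc t => Seq (tprog vr r t) (Push r true)
  | TAdd t u =>
      Seq (tprog vr r t) (Seq (tprog vr r.+1 u)
        (While r.+1 (Seq (Pop r.+1) (Push r true))))
  | TMul t u =>
      Seq (tprog vr r.+1 t) (Seq (tprog vr r.+2 u)
        (Seq (While r.+1 (Seq (Pop r.+1) (AddCopy r.+2 r r.+3)))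
             (Clear r.+2)))
  end.

Fixpoint fcost (L : nat) (F : form) : nat :=
  match F with
  | FBit z t => tcost L t + 13 * tbound L t + 10
  | FLt t u => tcost L u + tcost L t + 3 * tbound L t + 2 * tbound L u + 7
  | FNot F => fcost L F + 3
  | FAnd F G => fcost L F + fcost L G + 3
  | FEx x F => 10 * L + 5 + L.+1 * (fcost L F + 7)
  end.

(** The truth value is left in r as a stack of length 0 or 1. For [FEx] the loop counter in [r.+1]
    itself stores the variable: the extra [Push] makes it run through L, ..., 0 after each [Pop],
    and r collects the disjunction. *)
Fixpoint fprog (rL : nat) (vr : nat -> nat) (r : nat) (F : form) : prog :=
  match F with
  | FBit z t =>
      Seq (tprog vr r t) (Seq (While r (Seq (Pop r) (Move z r.+1)))
        (Seq (If z (Push r true) Skip Skip) (While r.+1 (Move r.+1 z))))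
  | FLt t u =>
      Seq (tprog vr r u) (Seq (tprog vr r.+1 t)
        (Seq (While r.+1 (Seq (Pop r.+1) (Pop r)))
             (If r (Seq (Clear r) (Push r true)) Skip Skip)))
  | FNot F => Seq (fprog rL vr r F) (If r (Pop r) (Pop r) (Push r true))
  | FAnd F G =>
      Seq (fprog rL vr r F) (If r (Seq (Pop r) (fprog rL vr r G)) Skip Skip)
  | FEx x F =>
      Seq (AddCopy rL r.+1 r.+2) (Seq (Push r.+1 true)
        (While r.+1 (Seq (Pop r.+1) (Seq (fprog rL (upd vr x r.+1) r.+2 F)
          (If r.+2 (Seq (Pop r.+2) (If r Skip Skip (Push r true))) Skip Skip)))))
  end.

Section Compile.

Variables (y w : seq bool) (rL : nat).
Let L := size y + size w.

(* Registers from r on are free; variable x lives in register [vr x], in unary. *)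
Record ready (e : store) (r : nat) (vr v : nat -> nat) : Prop := Ready {
  ready_y : e 0 = y;
  ready_w : e 1 = w;
  ready_r : 1 < r;
  ready_rL : rL < r;
  ready_L : e rL = nseq L true;
  ready_vr : forall x, vr x < r;
  ready_v : forall x, e (vr x) = nseq (v x) true;
  ready_vL : forall x, v x <= L;
  ready_free : forall j, r <= j -> e j = [::] }.

Lemma ready_upd e r vr v s : ready e r vr v -> ready (upd e r s) r.+1 vr v.
Proof.
case=> ey ew r1 rrL eL vrr ev vL ej.
split=> //; rewrite ?updE; try by [case: eqP => //; lia|lia].
- by move=> x; have := vrr x; lia.
- by move=> x; rewrite updE ltn_eqF.
- by move=> j lt_rj; rewrite updE gtn_eqF // ej // ltnW.
Qed.

Lemma upd_free e r vr v : ready e r vr v -> upd e r [::] = e.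
Proof.
move=> rd; apply: funext => j; rewrite updE; case: eqP => // ->.
by rewrite (ready_free rd).
Qed.

Lemma ready_next e r vr v : ready e r vr v -> ready e r.+1 vr v.
Proof. by move=> rd; rewrite -(upd_free rd); apply: ready_upd. Qed.

Lemma tprogP t : forall e r vr v, ready e r vr v ->
  runs (tprog vr r t) e (tcost L t) (upd e r (nseq (tval v t) true)).
Proof.
elim: t => [x||t IHt|t IHt u IHu|t IHt u IHu] e r vr v rd /=.
- have vrr := ready_vr rd x; have vL := ready_vL rd x.
  have := @runs_add_copy (vr x) r r.+1 e (v x) 0.
  rewrite addn0 => run; apply: runs_weak (run _ _ _ _ _ _) _ _ => //; try lia.
  + exact: ready_v rd x.
  + exact/(ready_free rd)/leqnSn.
  + exact/(ready_free rd)/leqnn.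
- by rewrite (upd_free rd); apply: runs_skip.
- apply: runs_weak (runs_seq (IHt _ _ _ _ rd) (runs_push _ _ _)) _ _ => //.
  by rewrite updE eqxx; store_tac.
- have bu := tval_bound u (ready_vL rd).
  have rd1 := ready_upd (nseq (tval v t) true) rd.
  set N := tval v u in bu *; set K := tval v t in rd1 *.
  pose f n := upd (upd e r (nseq (N - n + K) true)) r.+1 (nseq n true).
  have run := @runs_while r.+1 (Seq (Pop r.+1) (Push r true)) f N 3.
  apply: runs_weak (runs_seq (IHt _ _ _ _ rd)
    (runs_seq (IHu _ _ _ _ rd1) (e2 := f 0) (T2 := (N * 4).+1) _)) _ _; first 1 last.
  + by lia.
  + rewrite /f subn0 addnC; have e0 := ready_free rd (leqnSn _); store_tac.
  have -> : upd (upd e r (nseq K true)) r.+1 (nseq N true) = f N.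
    by rewrite /f subnn.
  apply: run => [n _|n lt_n]; first by rewrite /f updE eqxx size_nseq.
  apply: runs_weak (runs_seq (runs_pop _ _) (runs_push _ _ _)) _ _ => //.
  rewrite /f !updE !eqxx (ltn_eqF (ltnSn r)) /=.
  by have -> : N - n = (N - n.+1).+1; [lia | store_tac].
- have bt := tval_bound t (ready_vL rd); have bu := tval_bound u (ready_vL rd).
  have rd1 := ready_next rd.
  have rd2 := ready_upd (nseq (tval v t) true) rd1.
  set N := tval v t in bt rd2 *; set K := tval v u in bu *.
  pose f n := upd (upd (upd e r (nseq ((N - n) * K) true)) r.+1 (nseq n true))
    r.+2 (nseq K true).
  have run := @runs_while r.+1 (Seq (Pop r.+1) (AddCopy r.+2 r r.+3)) f N (10 * K + 3).
  apply: runs_weak (runs_seq (IHt _ _ _ _ rd1)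
    (runs_seq (IHu _ _ _ _ rd2) (runs_seq (e1 := f 0) (T1 := (N * (10 * K + 4)).+1) _
      (runs_clear _ _)))) _ _; first 1 last.
  + have : N * (10 * K + 4) <= tbound L t * (10 * tbound L u + 4).
      by apply: leq_mul => //; lia.
    by rewrite /f updE eqxx size_nseq; lia.
  + rewrite /f subn0; have e1 := ready_free rd (leqnSn _).
    have e2 : e r.+2 = [::] by apply: (ready_free rd); lia.
    by store_tac.
  have -> : upd (upd e r.+1 (nseq N true)) r.+2 (nseq K true) = f N.
    by rewrite /f subnn mul0n /= (upd_free rd).
  have -> : 10 * K + 4 = (10 * K + 3).+1 by lia.
  apply: run => [n _|n lt_n].
    by rewrite /f !updE eqxx (ltn_eqF (ltnSn r.+1)) size_nseq.
  apply: runs_weak (runs_seq (runs_pop _ _)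
    (@runs_add_copy r.+2 r r.+3 _ K ((N - n.+1) * K) _ _ _ _ _ _)) _ _; try lia.
  + by rewrite /f; upd_tac.
  + by rewrite /f; have e3 : e r.+3 = [::]; [apply: (ready_free rd); lia | upd_tac].
  + by rewrite /f; upd_tac.
  have -> : K + (N - n.+1) * K = (N - n) * K by rewrite -mulSn; congr muln; lia.
  by rewrite /f; store_tac.
Qed.

Lemma runs_move_top a c e : a <> c ->
  runs (Move a c) e 4 (upd (upd e a (behead (e a))) c (take 1 (e a) ++ e c)).
Proof.
move=> nac; case ea: (e a) => [|b s].
  apply: runs_weak (runs_if (T := 1) _) _ _; first 1 last; first by [].
  - by reflexivity.
  by rewrite ea; apply: runs_weak (runs_skip _) _ _ => //; store_tac.
by apply: runs_weak (runs_move nac ea) _ _ => //=; rewrite take0.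
Qed.

Lemma fprogP F : forall e r vr v, ready e r vr v ->
  runs (fprog rL vr r F) e (fcost L F) (upd e r (nseq `[< sat y w v F >] true)).
Proof.
elim: F => [z t|t u|F IHF|F IHF G IHG|x F IHF] e r vr v rd /=.
- have bt := tval_bound t (ready_vL rd); set N := tval v t in bt *.
  have lt_1r := ready_r rd; pose s := if z then w else y.
  have ez : e z = s by rewrite /s; case: (z); [apply: ready_w rd | apply: ready_y rd].
  have er : e r = [::] by apply: (ready_free rd).
  have er1 : e r.+1 = [::] by apply: (ready_free rd).
  have nzr : (z == r :> nat) = false by case: (z); lia.
  have nzr1 : (z == r.+1 :> nat) = false by case: (z); lia.
  (* With n positions still to skip, the word is split between its own stack and, reversed, the
     stack [r.+1]. *)
  pose f n := upd (upd (upd e r (nseq n true)) z (drop (N - n) s)) r.+1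
    (rev (take (N - n) s)).
  pose b := nth false s N.
  pose g n := upd (upd (upd e r (nseq b true)) z (drop n s)) r.+1 (rev (take n s)).
  have f1 := @runs_while r (Seq (Pop r) (Move z r.+1)) f N 5.
  (* [Move] does nothing on an empty stack, so a position beyond the end has moved only [size s]
     bits to be put back. *)
  have g1 := @runs_while r.+1 (Move r.+1 z) g (minn N (size s)) 4.
  apply: runs_weak (runs_seq (tprogP t rd) (runs_seq (e1 := f 0) (T1 := (N * 6).+1) _
    (runs_seq (e1 := g (minn N (size s))) (T1 := 3) _
      (e2 := g 0) (T2 := (minn N (size s) * 5).+1) _))) _ _.
  + have -> : upd e r (nseq (tval v t) true) = f N.
      by rewrite /f subnn drop0 take0 -/N; store_tac.
    apply: f1 => [n _|n lt_n].
      by rewrite /f !updE (eq_sym r z) nzr (ltn_eqF (ltnSn r)) eqxx size_nseq.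
    have nz : nat_of_bool z <> r.+1 by apply/eqP; rewrite nzr1.
    apply: runs_weak (runs_seq (runs_pop _ _) (runs_move_top _ nz)) _ _ => //.
    rewrite /f !updE (eq_sym r z) (eq_sym r.+1 z) (eq_sym r.+1 r) nzr nzr1
      (ltn_eqF (ltnSn r)) !eqxx /=.
    have -> : N - n = (N - n.+1).+1 by lia.
    have -> k : drop k.+1 s = behead (drop k s) by rewrite -drop1 drop_drop add1n.
    have -> : rev (take (N - n.+1).+1 s) =
        take 1 (drop (N - n.+1) s) ++ rev (take (N - n.+1) s).
      rewrite -addn1 takeD rev_cat; congr (_ ++ _).
      by case: (drop _ s) => // a l /=; rewrite take0.
    by store_tac.
  + apply: runs_if; rewrite /f subn0 updE nzr1 updE eqxx.
    have -> : branch (drop N s) (Push r true) Skip Skip = if b then Push r true else Skip.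
      rewrite /b; case: (ltnP N (size s)) => [lt_N|le_N].
        by rewrite (drop_nth false lt_N); case: (nth _ _ _).
      by rewrite drop_oversize // nth_default.
    have Eg : g (minn N (size s)) =
        upd (upd (upd e r (nseq b true)) z (drop N s)) r.+1 (rev (take N s)).
      rewrite /g; case: (leqP N (size s)) => [//|/ltnW le_N].
      by rewrite !drop_oversize ?take_oversize.
    rewrite {}Eg; case: (b) => /=.
      apply: runs_weak (runs_push _ _ _) _ _ => //.
      by rewrite !updE (eq_sym r z) nzr (ltn_eqF (ltnSn r)) eqxx; store_tac.
    by apply: runs_weak (runs_skip _) _ _.
  + apply: g1 => [n le_n|n lt_n].
      by rewrite /g updE eqxx size_rev size_takel; lia.
    have nz : r.+1 <> nat_of_bool z by apply/eqP; rewrite eq_sym nzr1.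
    apply: runs_weak (runs_move nz (b := nth false s n) (s := rev (take n s)) _) _ _ => //.
      rewrite /g updE eqxx (take_nth false) ?rev_rcons //; lia.
    rewrite /g !updE nzr1 eqxx -drop_nth; last by lia.
    by store_tac.
  + by have := geq_minl N (size s); lia.
  + rewrite /g drop0 take0 /b.
    have -> : `[< nth false (if z then w else y) (tval v t) >] = nth false s N.
      exact: asboolb.
    by store_tac.
- have bt := tval_bound t (ready_vL rd); have bu := tval_bound u (ready_vL rd).
  have rd1 := ready_upd (nseq (tval v u) true) rd.
  have er1 : e r.+1 = [::] by apply: (ready_free rd).
  set N := tval v t in bt *; set K := tval v u in bu rd1 *.
  (* Popping both stacks N times leaves K - N bits in r, none if K <= N; popping an empty stack
     agrees with truncated subtraction. *)
  pose f n := upd (upd e r (nseq (K - (N - n)) true)) r.+1 (nseq n true).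
  have f1 := @runs_while r.+1 (Seq (Pop r.+1) (Pop r)) f N 2.
  apply: runs_weak (runs_seq (tprogP u rd) (runs_seq (tprogP t rd1)
    (runs_seq (e1 := f 0) (T1 := (N * 3).+1) _ (runs_if (T := (2 * K + 3))
      (e' := upd e r (nseq (N < K) true)) _)))) _ _;
    first 1 last.
  + rewrite /f subn0 !updE (ltn_eqF (ltnSn r)) eqxx.
    case: (ltnP N K) => [lt_NK|le_KN] /=; last first.
      have -> : K - N = 0 by lia.
      apply: runs_weak (runs_skip _) _ _ => //=; first by lia.
      by store_tac.
    case E: (K - N) => [|d] /=; first by lia.
    apply: runs_weak (runs_seq (runs_clear _ _) (runs_push _ _ _)) _ _.
      by rewrite !updE (ltn_eqF (ltnSn r)) eqxx /= size_nseq; lia.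
    by rewrite updE eqxx; store_tac.
  + by lia.
  + by rewrite asboolb.
  have -> : upd (upd e r (nseq K true)) r.+1 (nseq (tval v t) true) = f N.
    by rewrite /f subnn subn0.
  apply: f1 => [n _|n lt_n]; first by rewrite /f updE eqxx size_nseq.
  apply: runs_weak (runs_seq (runs_pop _ _) (runs_pop _ _)) _ _ => //.
  rewrite /f !updE !eqxx (ltn_eqF (ltnSn r)) /=.
  have -> : K - (N - n) = (K - (N - n.+1)).-1 by lia.
  by case: (K - (N - n.+1)) => [|d] /=; store_tac.
- apply: runs_weak (runs_seq (IHF _ _ _ _ rd) (runs_if (T := 2) _)) _ _ => //.
  have er := ready_free rd (leqnn r).
  rewrite updE eqxx asbool_neg; case: `[< _ >] => /=.
    by apply: runs_weak (runs_pop _ _) _ _ => //; rewrite updE eqxx; store_tac.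
  by apply: runs_weak (runs_push _ _ _) _ _ => //; rewrite updE eqxx; store_tac.
- apply: runs_weak (runs_seq (IHF _ _ _ _ rd)
    (runs_if (T := (fcost L G).+1) _)) _ _ => //; last by lia.
  rewrite updE eqxx asbool_and; case: `[< sat y w v F >] => /=; last first.
    by apply: runs_weak (runs_skip _) _ _.
  rewrite -add1n; apply: runs_seq (runs_pop _ _) _.
  have -> : upd (upd e r [:: true]) r (behead (upd e r [:: true] r)) = e.
    rewrite updE eqxx /=; have er := ready_free rd (leqnn r); store_tac.
  exact: IHG.
- have er := ready_free rd (leqnn r).
  have er1 := ready_free rd (leqnSn r).
  have er2 : e r.+2 = [::] by apply: (ready_free rd); lia.
  (* The loop invariant: r tells whether some value already tried, that is from n to L, satisfies
     F. *)
  pose b n := `[< exists2 m, n <= m <= L & sat y w (upd v x m) F >].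
  pose f n := upd (upd e r (nseq (b n) true)) r.+1 (nseq n true).
  have := @runs_add_copy rL r.+1 r.+2 e L 0.
  have rLr := ready_rL rd; rewrite addn0 => run1.
  apply: runs_weak (runs_seq (run1 _ _ _ _ _ _) (runs_seq (runs_push _ _ _)
    (e2 := f 0) (T2 := (L.+1 * (fcost L F + 6).+1).+1) _)) _ _ => //; try lia.
  + exact: ready_L rd.
  + have b0 : b L.+1 = false.
      by apply/negbTE/asboolPn=> -[m /andP[] /leq_trans le /le]; rewrite ltnn.
    have -> : upd (upd e r.+1 (nseq L true)) r.+1
        (true :: upd e r.+1 (nseq L true) r.+1) = f L.+1.
      by rewrite /f b0 updE eqxx; store_tac.
    apply: runs_while => [n _|n]; first by rewrite /f updE eqxx size_nseq.
    rewrite ltnS => le_nL.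
    pose e1 := upd (upd e r (nseq (b n.+1) true)) r.+1 (nseq n true).
    have rd1 : ready e1 r.+2 (upd vr x r.+1) (upd v x n).
      have [ey ew r1 rrL eL vrr ev vL ej] := ready_upd (nseq n true)
        (ready_upd (nseq (b n.+1) true) rd).
      split=> // x'; rewrite ?(updE vr) ?(updE v); case: ifP => // _.
      by rewrite /e1 updE eqxx.
    apply: runs_weak (runs_seq (runs_pop _ _) (runs_seq (e1 := upd e1 r.+2
      (nseq `[< sat y w (upd v x n) F >] true)) (T1 := fcost L F) _ (e2 := f n)
      (T2 := 5) _)) _ _ => //; last by lia.
      have -> : upd (f n.+1) r.+1 (behead (f n.+1 r.+1)) = e1.
        by rewrite /f /e1 !updE eqxx /=; store_tac.
      exact: IHF.
    have bS : b n = `[< sat y w (upd v x n) F >] || b n.+1.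
      rewrite /b -asbool_or; apply: asbool_equiv_eq; split=> [[m /andP[le1 le2] Fm]|].
        move: le1; rewrite leq_eqVlt => /predU1P[->|lt]; first by left.
        by right; exists m => //; rewrite lt.
      case=> [Fn|[m /andP[le1 le2] Fm]]; first by exists n => //; rewrite leqnn.
      by exists m => //; rewrite le2 ltnW.
    apply: runs_if; rewrite updE eqxx /f bS; case: `[< _ >] => /=; last first.
      by apply: runs_weak (runs_skip _) _ _ => //; rewrite /e1; store_tac.
    apply: runs_weak (runs_seq (runs_pop _ _) (runs_if (T := 2) _)) _ _ => //.
    rewrite /e1 !updE !eqxx !ltn_eqF //.
    case: (b n.+1) => /=.
      by apply: runs_weak (runs_skip _) _ _ => //; store_tac.
    apply: runs_weak (runs_push _ _ _) _ _ => //.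
    by rewrite !updE eqxx !ltn_eqF //; store_tac.
  + have -> : `[< exists2 n, n <= size y + size w & sat y w (upd v x n) F >] = b 0.
      by apply: asbool_equiv_eq.
    by rewrite /f; store_tac.
Qed.

End Compile.

(** * Polynomial cost and the decision program *)

Definition nat_poly (g : nat -> nat) : Prop :=
  exists p : {poly nat}, forall n, g n = p.[n]%R.

Lemma nat_poly_const k : nat_poly (fun=> k).
Proof. by exists k%:P%R => n; rewrite hornerC. Qed.

Lemma nat_poly_id : nat_poly id.
Proof. by exists 'X%R => n; rewrite hornerX. Qed.

Lemma nat_polyD g h : nat_poly g -> nat_poly h -> nat_poly (fun n => g n + h n).
Proof. by move=> [p gp] [q hq]; exists (p + q)%R => n; rewrite hornerD gp hq. Qed.

Lemma nat_polyM g h : nat_poly g -> nat_poly h -> nat_poly (fun n => g n * h n).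
Proof. by move=> [p gp] [q hq]; exists (p * q)%R => n; rewrite hornerM gp hq. Qed.

Lemma nat_polyS g : nat_poly g -> nat_poly (fun n => (g n).+1).
Proof. by move=> [p gp]; exists (1 + p)%R => n; rewrite hornerD hornerC gp. Qed.

Lemma nat_polyX g k : nat_poly g -> nat_poly (fun n => g n ^ k).
Proof.
move=> gp; elim: k => [|k IHk]; first exact: (nat_poly_const 1).
have [p pE] := nat_polyM gp IHk; exists p => n; rewrite -pE; exact: expnS.
Qed.

Ltac nat_poly_tac := repeat first
  [ assumption | apply: nat_polyD | apply: nat_polyS | apply: nat_polyM
  | apply: nat_polyX | exact: nat_poly_id | exact: nat_poly_const ].

Lemma tbound_poly t : nat_poly (tbound ^~ t).
Proof. by elim: t => * /=; nat_poly_tac. Qed.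

Lemma tcost_poly t : nat_poly (tcost ^~ t).
Proof.
elim: t => [x||t IHt|t IHt u IHu|t IHt u IHu] /=;
  try have bt := tbound_poly t; try have bu := tbound_poly u; nat_poly_tac.
Qed.

Lemma fcost_poly F : nat_poly (fcost ^~ F).
Proof.
elim: F => [z t|t u|F IHF|F IHF G IHG|x F IHF] /=;
  try have bt := tbound_poly t; try have bu := tbound_poly u;
  try have ct := tcost_poly t; try have cu := tcost_poly u; nat_poly_tac.
Qed.

Definition Count (z r : nat) : prog :=
  Seq (While z (Move z r.+1)) (While r.+1 (Seq (Move r.+1 z) (Push r true))).

Lemma runs_count z r e K : z < r -> e r = nseq K true -> e r.+1 = [::] ->
  runs (Count z r) e (12 * size (e z) + 2) (upd e r (nseq (size (e z) + K) true)).
Proof.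
move=> zr er er1; set s := e z; pose N := size s.
have nz : z <> r.+1 by lia.
have nz' : r.+1 <> z by lia.
pose f n := upd (upd e z (drop (N - n) s)) r.+1 (rev (take (N - n) s)).
pose g n := upd (upd (upd e r (nseq (N - n + K) true)) z (drop n s)) r.+1
  (rev (take n s)).
have f1 := @runs_while z (Move z r.+1) f N 4.
have g1 := @runs_while r.+1 (Seq (Move r.+1 z) (Push r true)) g N 6.
apply: runs_weak (runs_seq (e1 := g N) (T1 := (N * 5).+1) _
  (e2 := g 0) (T2 := (N * 7).+1) _) _ _.
- have -> : g N = f 0.
    by rewrite /g /f subnn subn0; store_tac.
  have {1}-> : e = f N.
    by rewrite /f subnn drop0 take0 /s; store_tac.
  apply: f1 => [n le_n|n lt_n].
    by rewrite /f !updE (ltn_eqF (leqW zr)) eqxx size_drop -/N; lia.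
  apply: runs_weak (runs_move nz (b := nth false s (N - n.+1))
    (s := drop (N - n) s) _) _ _ => //.
    rewrite /f !updE (ltn_eqF (leqW zr)) eqxx (drop_nth false) -/N; last by lia.
    by have -> : N - n = (N - n.+1).+1 by lia.
  rewrite /f !updE eqxx; have -> : N - n = (N - n.+1).+1 by lia.
  by rewrite (take_nth false) -/N ?rev_rcons; [store_tac | lia].
- apply: g1 => [n le_n|n lt_n].
    by rewrite /g updE eqxx size_rev size_takel.
  apply: runs_weak (runs_seq (runs_move nz' (b := nth false s n)
    (s := rev (take n s)) _) (runs_push _ _ _)) _ _ => //.
    by rewrite /g updE eqxx (take_nth false) ?rev_rcons.
  rewrite /g !updE (ltn_eqF (leqW zr)) !eqxx (gtn_eqF zr) (ltn_eqF (ltnSn r)) -drop_nth //.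
  by have -> : N - n = (N - n.+1).+1; [lia | store_tac].
- by rewrite -/N; lia.
- by rewrite /g drop0 take0 subn0; store_tac.
Qed.

Definition decide (r : nat) (F : form) : prog :=
  Seq (Count 0 r) (Seq (Count 1 r) (Seq (fprog r (fun=> r) r.+1 F)
    (Seq (Clear 0) (If r.+1 (Push 0 true) Skip (Push 0 false))))).

Definition holds_on (F : form) (y w : seq bool) : bool :=
  `[< sat y w (fun=> size y + size w) F >].

Lemma runs_decide F r y w e : 1 < r -> e 0 = y -> e 1 = w ->
  (forall j, r <= j -> e j = [::]) ->
  exists2 e', runs (decide r F) e
    (14 * (size y + size w) + fcost (size y + size w) F + 8) e'
    & e' 0 = [:: holds_on F y w].
Proof.
move=> r1 e0 e1 ej; set L := size y + size w.
have [er er1] : e r = [::] /\ e r.+1 = [::] by split; apply: ej.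
have lt0r : 0 < r by apply: leq_trans r1.
have run0 := runs_count lt0r (K := 0) er er1.
set e2 := upd _ _ _ in run0.
have run1 : runs (Count 1 r) e2 (12 * size w + 2) (upd e r (nseq L true)).
  have e21 : e2 1 = w by rewrite /e2 updE ltn_eqF.
  have := @runs_count 1 r e2 (size y) r1 _ _.
  rewrite e21 => run; apply: runs_weak (run _ _) _ _ => //.
  - by rewrite /e2 updE eqxx e0 addn0.
  - by rewrite /e2 updE gtn_eqF.
  - by rewrite addnC -/L /e2; store_tac.
(* All variables start in the one register that holds L, which is why [holds_on] gives free
   variables the value L. *)
have rd : ready y w r (upd e r (nseq L true)) r.+1 (fun=> r) (fun=> L).
  split=> //; rewrite ?updE ?eqxx ?ltn_eqF //.
  by move=> j lt_rj; rewrite updE gtn_eqF // ej // ltnW.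
have run2 := fprogP F rd.
have := runs_clear 0 (upd (upd e r (nseq L true)) r.+1 (nseq (holds_on F y w) true)).
have r0 : (0 == r) = false by case: (r) lt0r.
rewrite !updE /= r0 e0; set e3 := upd (upd _ _ _) 0 _ => run3.
exists (upd e3 0 [:: holds_on F y w]); last by rewrite updE.
have run4 : runs (If r.+1 (Push 0 true) Skip (Push 0 false)) e3 3
    (upd e3 0 [:: holds_on F y w]).
  apply: runs_if; rewrite /e3 !updE /= eqxx.
  by case: (holds_on F y w) => /=; apply: runs_weak (runs_push _ _ _) _ _.
apply: runs_weak (runs_seq run0 (runs_seq run1 (runs_seq run2 (runs_seq run3 run4)))) _ _ => //.
by rewrite e0 /L; lia.
Qed.

Theorem polytime_rel_form (f : seq bool -> seq bool) (F : form) : polytime f ->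
  polytime_rel (fun x w => holds_on F (f x) w).
Proof.
move=> pf; apply: (@polytime_rel_comp f (holds_on F)) => // r r1.
have [p pE] : nat_poly (fun L => 14 * L + fcost L F + 8).
  by have := fcost_poly F => ?; nat_poly_tac.
exists (decide r F), p => y w e e0 e1 ej; rewrite -pE.
by have [e' [t le_t ex] e'0] := runs_decide F r1 e0 e1 ej; exists t, e'.
Qed.

(** * Vertex orders of bounded treewidth graphs *)

(** A simple path from t to u that does not begin with the edge itself has length at least two, and
    the edge closes it to a cycle. Deleting the orientation from t to u is enough, as a simple path
    starting in t never returns to t. *)
Lemma tree_edge_bridge (T : sgraph) (t u : T) : is_tree T -> adj t u ->
  ~~ connect [rel a b | adj a b && ~~ ((a == t) && (b == u))] t u.
Proof.
move=> [_ _ acyc] tu; apply/negP=> /connectP[p0 p0P uE].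
move: uE; case/shortenP: p0P => p pP uniq_p _ uE.
case: p pP uniq_p uE => [|b [|b' p]] pP uniq_p uE.
- by move: tu; rewrite uE adj_irr.
- by move: pP; rewrite uE /= !eqxx /= andbF.
apply: (acyc [:: t, b, b' & p]) => //; apply/andP; split=> //.
rewrite /cycle rcons_path; apply/andP; split; last by rewrite -/(last t [:: b, b' & p]) -uE adj_sym.
by apply: (sub_path _ pP) => x y /andP[].
Qed.

Definition avoid (T : sgraph) (t : T) : rel T :=
  [rel a b | [&& adj a b, a != t & b != t]].

Lemma avoid_sym (T : sgraph) (t : T) : connect_sym (avoid t).
Proof. by apply: sym_connect_sym => a b; rewrite /avoid /= adj_sym [(a != t) && _]andbC. Qed.

Lemma avoid_closed (T : sgraph) (t a b : T) : a != t -> connect (avoid t) a b -> b != t.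
Proof.
move=> nat /connectP[p pP ->]; elim: p a nat pP => //= c p IHp a _ /andP[/and3P[_ _ nct]].
exact: IHp.
Qed.

Lemma connect_invariant (T : finType) (e : rel T) (P : pred T) (x y : T) :
  (forall a b, e a b -> P a -> P b) -> P x -> connect e x y -> P y.
Proof.
move=> eP Px /connectP[p pP ->]; elim: p x Px pP => //= a p IHp x Px /andP[xa].
by apply: IHp; apply: eP xa Px.
Qed.

Section Centroid.

Variables (G T : sgraph) (bag : T -> {set G}) (U : {set G}).
Hypothesis dec : tree_decomposition bag.

(** The part of U that lies strictly on the side of a when the node t is deleted from the tree. *)
Let part (t a : T) : {set G} :=
  [set v in U | (v \notin bag t) && [exists b, (v \in bag b) && connect (avoid t) a b]].

(** The nodes whose bags contain v form a subtree; if it misses t, it lies on one side of t. *)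
Lemma avoid_bag t v a b : v \notin bag t -> v \in bag a -> v \in bag b ->
  connect (avoid t) a b.
Proof.
move=> vt va vb; have [_ _ _ /(_ v a b va vb)] := dec.
apply: connect_sub => c d /and3P[cd vc vd]; apply: connect1; apply/and3P; split=> //.
  by apply: contraNneq vt => <-.
by apply: contraNneq vt => <-.
Qed.

(** Otherwise every node has a side holding more than half of U. Take such a pair (t, a) whose side
    has the fewest tree nodes, and let u be the neighbour of t on that side. The heavy side of u
    shares a vertex of U with the heavy side of t, so it must point away from t; then it lies inside
    the side of a and misses u, against minimality. *)
Lemma centroid : exists t, forall a, a != t -> 2 * #|part t a| <= #|U|.
Proof.
have [tree _ _ _] := dec; have [/card_gt0P[t0 _] conn _] := tree.
apply: contrapT => no_centroid.
have heavy t : exists a, (a != t) && (#|U| < 2 * #|part t a|).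
  apply: contrapT => light; apply: no_centroid; exists t => a nat.
  by rewrite leqNgt; apply/negP=> gt; apply: light; exists a; rewrite nat.
have [a0 Pa0] := heavy t0.
pose P (ta : T * T) := (ta.2 != ta.1) && (#|U| < 2 * #|part ta.1 ta.2|).
pose C (ta : T * T) := [set b | connect (avoid ta.1) ta.2 b].
have P0 : P (t0, a0) by [].
case: (arg_minnP (fun ta => #|C ta|) P0) => -[t a] /andP[/= nat big] min_ta.
have [u tu ua] : exists2 u, adj t u & connect (avoid t) a u.
  have /connectP[p0 p0P aE] := conn t a; move: aE.
  case/shortenP: p0P => -[|u p] pP uniq_p _ /= aE; first by rewrite aE eqxx in nat.
  case/andP: pP => tu pP; exists u => //; rewrite avoid_sym; apply/connectP.
  exists p => //; case/andP: uniq_p => /=; rewrite inE negb_or => /andP[ntu tp] _.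
  elim: p u {tu aE} pP ntu tp => //= b p IHp u /andP[ub bp] ntu.
  rewrite inE negb_or => /andP[ntb tp]; apply/andP; split; last exact: IHp.
  by rewrite /avoid /= ub !(eq_sym _ t) ntu ntb.
have nut := avoid_closed nat ua.
have [a' /andP[na'u big']] := heavy u.
have [v] : exists v, v \in part t a :&: part u a'.
  apply/set0Pn; rewrite -card_gt0 lt0n; apply/negP=> /eqP I0.
  have := cardsUI (part t a) (part u a'); rewrite I0.
  have : #|part t a :|: part u a'| <= #|U|.
    by apply/subset_leq_card/subsetP=> v; rewrite !inE => /orP[] /andP[].
  by lia.
rewrite !inE => /andP[/and3P[_ vt /existsP[b /andP[vb ab]]]].
move=> /and3P[_ vu /existsP[b' /andP[vb' ab']]].
have a'b : connect (avoid u) a' b.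
  by apply: connect_trans ab' _; apply: avoid_bag vb.
have ub : connect (avoid t) u b.
  by apply: connect_trans ab; rewrite avoid_sym.
(* If the heavy side of u contained t, walking from t to b without u and from b to u without t would
   bypass the bridge between t and u. *)
case: (boolP (connect (avoid u) a' t)) => a't.
  have /negP := tree_edge_bridge tree tu; apply.
  apply: (@connect_trans _ _ b).
    have : connect (avoid u) t b by apply: connect_trans a'b; rewrite avoid_sym.
    apply: connect_sub => c d /and3P[cd ncu ndu]; apply: connect1.
    by rewrite /= cd negb_and ndu orbT.
  have : connect (avoid t) b u by rewrite avoid_sym.
  apply: connect_sub => c d /and3P[cd nct ndt]; apply: connect1.
  by rewrite /= cd negb_and nct.
have := min_ta (u, a'); rewrite /P /= na'u big' => /(_ isT); apply/negP; rewrite -ltnNge.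
apply/proper_card/properP; split; last first.
  exists u; rewrite inE //=; apply/negP=> /(avoid_closed na'u).
  by rewrite eqxx.
apply/subsetP=> d; rewrite !inE /= => a'd.
suff /andP[] : connect (avoid t) a d && connect (avoid u) a' d by [].
apply: (@connect_invariant _ (avoid u)
  (fun d => connect (avoid t) a d && connect (avoid u) a' d) b) => [c d' cd' /andP[ac a'c]||].
- have a'd' := connect_trans a'c (connect1 cd'); rewrite a'd' andbT.
  apply: connect_trans ac _; apply: connect1; case/and3P: cd' => cd' _ _.
  by apply/and3P; split=> //; apply: contraNneq a't => <-.
- by rewrite ab.
- by apply: connect_trans a'd; rewrite avoid_sym.
Qed.

End Centroid.

(* The bound on the live vertices makes a left-to-right elimination along s a
   dynamic programme over a path decomposition of width k. *)
Definition narrow (G : sgraph) (k : nat) (s : seq G) : Prop :=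
  forall a b, s = a ++ b -> #|[set x in a | has (adj x) b]| <= k.

Definition orders (G : sgraph) (s : seq G) (U : {set G}) : Prop :=
  uniq s /\ s =i U.

Lemma cat_eq_cat (T : Type) (a b c d : seq T) : a ++ b = c ++ d ->
  (exists2 u, c = a ++ u & b = u ++ d) \/ (exists2 u, a = c ++ u & d = u ++ b).
Proof.
elim: a c => [|x a IHa] [|z c] //= E.
- by left; exists [::].
- by left; exists (z :: c).
- by right; exists (x :: a).
case: E => <- /IHa[] [u -> ->]; first by left; exists u.
by right; exists u.
Qed.

(** Without edges between the lists, the live vertices at any cut all lie in the list that is being
    cut. *)
Lemma narrow_cat_separated (G : sgraph) k (s1 s2 : seq G) :
  (forall x y, x \in s1 -> y \in s2 -> ~~ adj x y) ->
  narrow k s1 -> narrow k s2 -> narrow k (s1 ++ s2).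
Proof.
move=> sep n1 n2 a b /cat_eq_cat[] [u].
- move=> -> s2E; apply: leq_trans (n2 u b s2E).
  apply/subset_leq_card/subsetP=> x; rewrite !inE mem_cat => /andP[+ xb].
  rewrite xb andbT => /orP[xs1|//]; case/hasP: xb => y yb xy.
  by have := sep x y xs1; rewrite s2E mem_cat yb orbT xy => /(_ isT).
- move=> s1E ->; apply: leq_trans (n1 a u s1E).
  apply/subset_leq_card/subsetP=> x; rewrite !inE has_cat => /andP[xa].
  rewrite xa => /orP[//|/hasP[y ys2 xy]].
  by have := sep x y; rewrite s1E mem_cat xa ys2 xy => /(_ isT isT).
Qed.

Lemma narrow_cat (G : sgraph) k (s1 s2 : seq G) :
  narrow k s2 -> narrow (size s1 + k) (s1 ++ s2).
Proof.
move=> n2 a b /cat_eq_cat[] [u].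
- move=> -> s2E; apply: (@leq_trans (#|s1| + #|[set x in u | has (adj x) b]|)).
    rewrite -[#|s1|]cardsE; apply: leq_trans (leq_card_setU _ _).1.
    apply/subset_leq_card/subsetP=> x; rewrite !inE mem_cat => /andP[+ ->].
    by rewrite andbT.
  by apply: leq_add; [apply: card_size | apply: n2].
- move=> -> _; apply: leq_trans (leq_addr _ _); rewrite size_cat.
  apply: leq_trans (leq_addr _ _); apply: leq_trans (card_size a).
  by apply/subset_leq_card/subsetP=> x; rewrite inE => /andP[].
Qed.

Definition inside (G : sgraph) (X : {set G}) : rel G :=
  [rel u v | [&& adj u v, u \in X & v \in X]].

(** Distinct components are not adjacent, so concatenating their orders does not add up their
    widths. The induction peels off one component at a time. *)
Lemma narrow_components (G : sgraph) h k (X : {set G}) :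
  (forall C : {set G}, #|C| <= h -> exists2 s, orders s C & narrow k s) ->
  (forall x, x \in X -> #|[set y | connect (inside X) x y]| <= h) ->
  exists2 s, orders s X & narrow k s.
Proof.
move=> ord; have [n] := ubnP #|X|; elim: n X => // n IHn X le_X comps.
case: (set_0Vmem X) => [->|[x xX]]; first by apply: ord; rewrite cards0.
pose C := [set y | connect (inside X) x y].
have CX : C \subset X.
  apply/subsetP=> y; rewrite inE; apply: connect_invariant xX => a b.
  by case/and3P.
have xC : x \in C by rewrite inE.
have [s1 [u1 m1] n1] := ord C (comps x xX).
have [||s2 [u2 m2] n2] := IHn (X :\: C).
- rewrite -ltnS; apply: leq_trans le_X; rewrite ltnS; apply/proper_card.
  rewrite properEneq subsetDl andbT; apply: contraTneq xX => <-.
  by rewrite !inE connect0.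
- move=> y; rewrite inE => /andP[_ yX]; apply: leq_trans (comps y yX).
  apply/subset_leq_card/subsetP=> z; rewrite !inE; apply: connect_sub => a b.
  case/and3P=> ab; rewrite !inE => /andP[_ aX] /andP[_ bX].
  by apply: connect1; rewrite /inside /= ab aX.
exists (s1 ++ s2); first split.
- rewrite cat_uniq u1 u2 andbT; apply/hasPn=> y; rewrite m1 m2 in_setD.
  by case/andP.
- move=> y; rewrite mem_cat m1 m2 in_setD.
  by case: (boolP (y \in C)) => //= yC; rewrite (subsetP CX).
apply: narrow_cat_separated => // a b; rewrite m1 m2 in_setD => aC /andP[bC bX].
apply: contraNN bC => ab; rewrite inE; move: (aC); rewrite inE => xa.
by apply: connect_trans xa (connect1 _); rewrite /inside /= ab bX (subsetP CX).
Qed.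

(** The centroid bag comes first and may stay live to the end, at a cost of d per level; the rest
    falls into components of at most half the size. The decomposition of G serves all levels, and
    only the set U to be halved shrinks. *)
Lemma narrow_order (G T : sgraph) (bag : T -> {set G}) d :
  tree_decomposition bag -> (forall t, #|bag t| <= d) ->
  forall k (U : {set G}), #|U| < 2 ^ k ->
  exists2 s, orders s U & narrow (d * k) s.
Proof.
move=> dec bag_d; elim=> [|k IHk] U ltU.
  have /eqP -> : U == set0 by rewrite -cards_eq0; move: ltU; rewrite expn0; lia.
  exists [::]; first by split=> // x; rewrite inE.
  by move=> [|//] b _; apply: leq_trans (_ : #|set0 : {set G}| <= _);
    [apply/subset_leq_card/subsetP=> x; rewrite inE | rewrite cards0].
have [t light] := centroid U dec.
have [|x|s2 [u2 m2] n2] := @narrow_components G (#|U| %/ 2) (d * k) (U :\: bag t).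
- by move=> C leC; apply: IHk; move: ltU; rewrite expnS; lia.
- rewrite !inE => /andP[xt xU].
  have [_ /(_ x)[a xa] edge _] := dec.
  have nat : a != t by apply: contraNneq xt => <-.
  have := light a nat; set P := [set v in U | _] => leP.
  rewrite leq_divRL // mulnC; apply: leq_trans leP; rewrite leq_pmul2l //.
  apply/subset_leq_card/subsetP=> z; rewrite inE.
  apply: (@connect_invariant _ _ (fun z => z \in P)); last first.
    by rewrite !inE xU xt /=; apply/existsP; exists a; rewrite xa connect0.
  move=> v v' /and3P[vv']; rewrite !inE => /andP[vt vU] /andP[v't v'U].
  rewrite vU vt v'U v't /= => /existsP[b /andP[vb ab]].
  have [b' /andP[vb' v'b']] := edge v v' vv'.
  apply/existsP; exists b'; rewrite v'b'; apply: connect_trans ab _.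
  exact: (avoid_bag dec vt).
exists (enum (U :&: bag t) ++ s2); first split.
- rewrite cat_uniq enum_uniq u2 andbT; apply/hasPn=> y.
  by rewrite m2 mem_enum !inE => /andP[/negPf-> ->].
- move=> y; rewrite mem_cat m2 mem_enum !inE.
  by case: (y \in U); case: (y \in bag t).
move=> a b E; apply: leq_trans (narrow_cat n2 E) _.
rewrite -cardE mulnS leq_add2r; apply: leq_trans (bag_d t).
by apply: subset_leq_card; apply: subsetIr.
Qed.

Lemma treewidth_narrow_order (G : sgraph) c : treewidth G <= c ->
  forall k (U : {set G}), #|U| < 2 ^ k ->
  exists2 s, orders s U & narrow (c.+1 * k) s.
Proof.
rewrite /treewidth; case: ex_minnP => tw /asboolP[T [bag [dec wE]]] _ le_c.
apply: narrow_order dec _ => t; apply: leq_trans (leqSpred _) _; rewrite ltnS.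
apply: leq_trans le_c; rewrite -wE /width -!subn1; apply: leq_sub2r.
exact: (leq_bigmax (F := fun t => #|bag t|)).
Qed.

(** * Derivations of expansion lower bounds *)

Section Judgement.

Variable G : sgraph.
Implicit Types (A W O X : {set G}) (u v : G) (i m : nat).

(** X completes the choice inside A. Forgotten vertices are not counted, and for empty W and O this
    is the neighbourhood of X in the subgraph induced on A. *)
Definition touched A W O X : {set G} :=
  [set u in O :|: (A :\: X) | [exists v in X :|: W, adj v u]].

(* A: undecided vertices, W: chosen vertices, O: rejected vertices that are not
   yet counted as neighbours of a chosen one. *)
Definition judgement A W O i m : Prop :=
  forall X, X \subset A -> #|X| = i -> m <= #|touched A W O X|.

Lemma touched_in A W O X u : u \in A ->
  touched (A :\ u) (u |: W) O X = touched A W O (u |: X).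
Proof.
move=> uA; apply/setP=> x; rewrite !inE; congr (_ && _).
  by case: (x \in O) => //=; case: (x == u); case: (x \in X) => //=; rewrite ?andbF.
by apply: eq_existsb => v; rewrite !inE; case: (v == u); case: (v \in X).
Qed.

Lemma touched_out A W O X u : u \in A -> u \notin X ->
  touched (A :\ u) W (u |: O) X = touched A W O X.
Proof.
move=> uA uX; apply/setP=> x; rewrite !inE; congr (_ && _).
by case: eqP => //= ->; rewrite uA uX orbT.
Qed.

Lemma judgement_branch A W O i m u : u \in A ->
  (0 < i -> judgement (A :\ u) (u |: W) O i.-1 m) ->
  judgement (A :\ u) W (u |: O) i m -> judgement A W O i m.
Proof.
move=> uA Jin Jout X sXA cX; case: (boolP (u \in X)) => uX; last first.
  rewrite -(touched_out _ _ uA uX); apply: Jout => //.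
  by rewrite subsetD1 sXA uX.
have := cardsD1 u X; rewrite uX cX => iE.
rewrite -(setD1K uX) -(touched_in _ _ _ uA); apply: Jin; first by lia.
  by apply: setSD.
by lia.
Qed.

Lemma judgement_branch_in A W O i m u : u \in A -> 0 < i ->
  judgement A W O i m -> judgement (A :\ u) (u |: W) O i.-1 m.
Proof.
move=> uA i0 J X; rewrite subsetD1 => /andP[sXA uX] cX; rewrite touched_in //.
apply: J; first by rewrite subUset sub1set uA.
by rewrite cardsU1 uX cX; lia.
Qed.

Lemma judgement_branch_out A W O i m u : u \in A ->
  judgement A W O i m -> judgement (A :\ u) W (u |: O) i m.
Proof.
move=> uA J X; rewrite subsetD1 => /andP[sXA uX] cX; rewrite touched_out //.
exact: J.
Qed.

Lemma card_touched_resolve A W O X u v : u \in O -> v \in W -> adj v u -> u \notin A ->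
  #|touched A W O X| = #|touched A W (O :\ u) X|.+1.
Proof.
move=> uO vW vu uA; rewrite (cardsD1 u).
have -> : u \in touched A W O X.
  rewrite !inE uO; apply/existsP; exists v; by rewrite !inE vW orbT.
rewrite add1n; congr _.+1; apply: eq_card => x; rewrite !inE.
by case: eqP => //= ->; rewrite (negPf uA) andbF.
Qed.

Lemma judgement_resolve A W O i m u v : u \in O -> v \in W -> adj v u -> u \notin A ->
  judgement A W (O :\ u) i m.-1 <-> judgement A W O i m.
Proof.
move=> uO vW vu uA; split=> J X sX cX; have := J X sX cX;
  by rewrite (card_touched_resolve _ uO vW vu uA); lia.
Qed.

(** [touched] grows with W and O, so forgetting is always sound; [judgement_dropW] and
    [judgement_dropO] give conditions under which it also loses nothing. *)
Lemma judgement_sub A W O W' O' i m : W' \subset W -> O' \subset O ->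
  judgement A W' O' i m -> judgement A W O i m.
Proof.
move=> sW sO J X sX cX; apply: leq_trans (J X sX cX) _.
apply/subset_leq_card/subsetP=> x; rewrite !inE => /andP[/orP[xO|xA] /existsP[v]].
  rewrite !inE (subsetP sO) //= => /andP[vXW vx]; apply/existsP; exists v.
  by rewrite !inE vx andbT; case/orP: vXW => [->//|/(subsetP sW)->]; rewrite orbT.
rewrite !inE xA orbT /= => /andP[vXW vx]; apply/existsP; exists v.
by rewrite !inE vx andbT; case/orP: vXW => [->//|/(subsetP sW)->]; rewrite orbT.
Qed.

(** Everything touched lies in A or O, so a chosen vertex without neighbours there contributes
    nothing. *)
Lemma judgement_dropW A W O i m u :
  (forall v, v \in A :|: O -> ~~ adj u v) ->
  judgement A W O i m -> judgement A (W :\ u) O i m.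
Proof.
move=> far J X sX cX; apply: leq_trans (J X sX cX) _.
apply/subset_leq_card/subsetP=> x; rewrite !inE => /andP[xAO /existsP[v]].
rewrite xAO !inE => /andP[vXW vx]; apply/existsP; exists v; rewrite !inE vx andbT.
case: eqP => [vu|//]; rewrite -vu in far *; case/orP: vXW => [->//|_].
suff /far : x \in A :|: O by rewrite vx.
rewrite !inE.
by case/orP: xAO => [->|/andP[_ ->]]; rewrite ?orbT.
Qed.

Lemma judgement_dropO A W O i m u : u \notin A ->
  (forall v, v \in A :|: W -> ~~ adj v u) ->
  judgement A W O i m -> judgement A W (O :\ u) i m.
Proof.
move=> uA far J X sX cX; apply: leq_trans (J X sX cX) _.
apply/subset_leq_card/subsetP=> x; rewrite !inE => /andP[xAO /existsP[v]].
rewrite !inE => /andP[vXW vx]; apply/andP; split; last first.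
  by apply/existsP; exists v; rewrite !inE vXW.
case: eqP => [xu|//]; rewrite xu in vx.
suff /far : v \in A :|: W by rewrite vx.
rewrite !inE.
by case/orP: vXW => [/(subsetP sX)->|->]; rewrite ?orbT.
Qed.

End Judgement.

(** The first bit says that the vertex is chosen or still can be, the second that it is rejected and
    uncounted or still can be. *)
Definition label := (bool * bool)%type.
Definition LA : label := (true, true).
Definition LW : label := (true, false).
Definition LO : label := (false, true).
Definition LN : label := (false, false).

Section Derivation.

Variables (G : sgraph) (S : Type) (lab : S -> G -> label).
Variable claim : S -> nat -> nat -> Prop.

Definition same_off (s s' : S) (u : G) : Prop := forall v, v <> u -> lab s' v = lab s v.

(** The second rule is vacuous truth: vertices remain to be chosen but none is undecided. The others
    are deciding u, counting u, and forgetting u. *)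
Definition justified (s : S) (i m : nat) : Prop :=
  [\/ m = 0, 0 < i /\ (forall u, lab s u <> LA)
    | exists u s', same_off s s' u /\
      [\/ [/\ lab s u = LA, lab s' u = LO, claim s' i m
            & 0 < i -> exists s'',
              [/\ same_off s s'' u, lab s'' u = LW & claim s'' i.-1 m]],
          [/\ lab s u = LO, lab s' u = LN, (exists2 v, lab s v = LW & adj v u)
            & claim s' i m.-1]
        | [/\ lab s u = LW \/ lab s u = LO, lab s' u = LN & claim s' i m]]].

Definition lab_set (x : label) (s : S) : {set G} := [set u | lab s u == x].

Lemma lab_set_upd x s s' u : same_off s s' u ->
  lab_set x s' = if lab s' u == x then u |: lab_set x s else lab_set x s :\ u.
Proof.
move=> same; apply/setP=> v.
by case: ifP => lx; rewrite !inE; case: (v =P u) => [->|/same->].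
Qed.

Lemma lab_setD1 x s u : lab s u <> x -> lab_set x s :\ u = lab_set x s.
Proof.
move=> nx; apply/setP=> v; rewrite !inE; case: eqP => //= ->.
by apply/esym/negbTE/eqP.
Qed.

Definition lab_judgement s := judgement (lab_set LA s) (lab_set LW s) (lab_set LO s).

(** Lines carry no order. Instead the measure gives 2 to an undecided vertex and 1 to a chosen or
    rejected one, and every premise has a smaller measure. The bound n on the counters is inherited,
    as no rule increases them going to a premise. *)
Lemma derivation_sound n :
  (forall s i m, i <= n -> m <= n -> claim s i m -> justified s i m) ->
  forall s i m, i <= n -> m <= n -> claim s i m -> lab_judgement s i m.
Proof.
move=> just s.
have [k] := ubnP (2 * #|lab_set LA s| + #|lab_set LW s| + #|lab_set LO s|).
elim: k s => // k IHk s lt_k i m le_i le_m /(just s i m le_i le_m) [->//||].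
  move=> [i0 noA] X; have -> : lab_set LA s = set0.
    by apply/setP=> u; rewrite !inE; apply/eqP.
  by rewrite subset0 => /eqP->; rewrite cards0 => i0'; rewrite -i0' in i0.
move=> [u [s' [same]]]; have upd x := lab_set_upd x same.
move: (upd LA) (upd LW) (upd LO) => {upd} uA uW uO.
case=> [[lu l'u c' c'']|[lu l'u [v vW vu] c']|[lu l'u c']].
- rewrite l'u /= in uA uW uO; rewrite (@lab_setD1 LW) ?lu // in uW.
  have uLA : u \in lab_set LA s by rewrite inE lu.
  have uLO : u \notin lab_set LO s by rewrite inE lu.
  have cA := cardsD1 u (lab_set LA s); rewrite uLA in cA.
  have cO := cardsU1 u (lab_set LO s); rewrite uLO in cO.
  apply: (judgement_branch uLA); last first.
    rewrite -uA -uW -uO; apply: IHk => //.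
    by rewrite uA uW uO cO; lia.
  move=> i0; have [s'' [same'' l''u c2]] := c'' i0.
  have upd x := lab_set_upd x same''.
  move: (upd LA) (upd LW) (upd LO) => {upd} vA vW vO.
  rewrite l''u /= in vA vW vO; rewrite (@lab_setD1 LO) ?lu // in vO.
  have uLW : u \notin lab_set LW s by rewrite inE lu.
  have cW := cardsU1 u (lab_set LW s); rewrite uLW in cW.
  rewrite -vA -vW -vO; apply: IHk => //; last by lia.
  by rewrite vA vW vO cW; lia.
- rewrite l'u /= in uA uW uO.
  rewrite (@lab_setD1 LW) ?lu // in uW; rewrite (@lab_setD1 LA) ?lu // in uA.
  have uLO : u \in lab_set LO s by rewrite inE lu.
  have cO := cardsD1 u (lab_set LO s); rewrite uLO in cO.
  apply/(@judgement_resolve _ _ _ _ _ _ u v) => //; rewrite ?inE ?lu ?vW //.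
  rewrite -uA -uW -uO; apply: IHk => //; last by lia.
  by rewrite uA uW uO; lia.
- rewrite l'u /= in uA uW uO.
  rewrite (@lab_setD1 LA) in uA; last by case: lu => ->.
  apply: (@judgement_sub _ _ _ _ (lab_set LW s') (lab_set LO s')).
  + by rewrite uW subD1set.
  + by rewrite uO subD1set.
  rewrite -uA; apply: IHk => //.
  have cO := cardsD1 u (lab_set LO s); have cW := cardsD1 u (lab_set LW s).
  rewrite uA uW uO; case: lu => lu; rewrite !inE lu /= in cO cW; lia.
Qed.

End Derivation.

(** * Short derivations from narrow orders *)

Section Completeness.

Variables (G : sgraph) (s : seq G) (k : nat).
Hypotheses (uniq_s : uniq s) (narrow_s : narrow k s).

Let rest j : {set G} := [set x in drop j s].
Let live j : {set G} := [set x in take j s | has (adj x) (drop j s)].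

(** Room for W and O after j decisions. It uses the vertices live before the last decision, together
    with the vertex just decided: those that have just ceased to be live must stay until they are
    counted or forgotten. *)
Definition slot (j : nat) : {set G} :=
  if j is i.+1 then live i :|: [set x in take 1 (drop i s)] else set0.

Lemma card_slot j : #|slot j| <= k.+1.
Proof.
case: j => [|j]; first by rewrite cards0.
apply: leq_trans (leq_card_setU _ _).1 _; rewrite -[k.+1]addn1; apply: leq_add.
  by apply: narrow_s; rewrite cat_take_drop.
by rewrite cardsE; apply: leq_trans (card_size _) _; rewrite size_take; case: ifP; lia.
Qed.

Lemma slot_seen j u : u \in slot j -> u \in take j s.
Proof.
case: j => [|j]; rewrite /slot; first by rewrite inE.
rewrite !inE -[j.+1]addn1 takeD mem_cat => /orP[/andP[-> _] //|->].
by rewrite orbT.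
Qed.

Lemma slot_rest j u : u \in slot j -> u \notin rest j.
Proof.
move=> /slot_seen; rewrite inE => ut; move: uniq_s.
by rewrite -{1}(cat_take_drop j s) cat_uniq => /and3P[_ /hasPn no _]; apply: contraL ut => /no.
Qed.

Definition good_state (x : 'I_(size s).+1 * ({set G} * {set G})) : bool :=
  [&& x.2.1 \subset slot x.1, x.2.2 \subset slot x.1 & [disjoint x.2.1 & x.2.2]].

Definition dp_state := {x | good_state x}.

Definition dp_label (x : dp_state) (u : G) : label :=
  let: (j, (W, X)) := val x in ((u \in rest j) || (u \in W), (u \in rest j) || (u \in X)).

(** Every true judgement at these states is claimed, so completeness reduces to finding true
    premises for a true judgement. *)
Definition dp_claim (x : dp_state) (i m : nat) : Prop :=
  let: (j, (W, X)) := val x in judgement (rest j) W X i m.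

Lemma card_dp_state : #|{: dp_state}| <= (size s).+1 * 4 ^ k.+1.
Proof.
rewrite card_sig -sum1_card.
have -> : \sum_(x in [pred x | good_state x]) 1 =
    \sum_j \sum_(p | good_state (j, p)) 1.
  by rewrite pair_big_dep; apply: eq_bigl => -[].
apply: leq_trans (_ : \sum_(j < (size s).+1) 4 ^ k.+1 <= _); last first.
  by rewrite sum_nat_const card_ord.
apply: leq_sum => j _; rewrite sum1dep_card.
apply: (@leq_trans #|setX (powerset (slot j)) (powerset (slot j))|).
  apply/subset_leq_card/subsetP=> -[W O]; rewrite !inE /= => /and3P[/= -> ->] //.
rewrite cardsX !card_powerset -expnD -[4]/(2 ^ 2) -expnM leq_exp2l //.
by have := card_slot j; lia.
Qed.

(** The rules are tried in a fixed order: count all rejected vertices with a chosen neighbour, then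
    forget vertices that are not live, and only then decide the next vertex. Counting first ensures
    that forgetting loses nothing; forgetting first keeps W and O within the next slot. *)
Lemma dp_justified x i m : dp_claim x i m -> justified dp_label dp_claim x i m.
Proof.
case: x => -[j [W O]] gx; rewrite /dp_claim /= => J.
have /and3P[/= sW sO dWO] := gx.
have WA u : u \in W -> u \notin rest j by move/(subsetP sW)/slot_rest.
have OA u : u \in O -> u \notin rest j by move/(subsetP sO)/slot_rest.
have OW u : u \in O -> u \notin W.
  by move=> uO; apply: contraTN uO => uW; rewrite (disjointFr dWO uW).
pose y : dp_state := exist (fun x => good_state x) _ gx.
have labO u : u \in O -> dp_label y u = LO.
  by move=> uO; rewrite /dp_label /= uO (negPf (OA u uO)) (negPf (OW u uO)).
have labW u : u \in W -> dp_label y u = LW.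
  move=> uW; rewrite /dp_label /= uW (negPf (WA u uW)) /=.
  by rewrite (disjointFr dWO uW).
have [->|m0] := eqVneq m 0; first by constructor 1.
have dropO u : u \in O -> exists y' : dp_state, [/\ val y' = (j, (W, O :\ u)),
    same_off dp_label y y' u & dp_label y' u = LN].
  move=> uO; have gy : good_state (j, (W, O :\ u)).
    rewrite /good_state /= sW (subset_trans _ sO) ?subD1set //=.
    by apply: disjointWr dWO; apply: subD1set.
  exists (exist (fun x => good_state x) _ gy); split=> //.
    by move=> v /eqP vu; rewrite /dp_label /= !inE vu.
  by rewrite /dp_label /= in_setD1 eqxx (negPf (OA u uO)) (negPf (OW u uO)).
have [|nres] := boolP [exists u in O, [exists v in W, adj v u]].
  case/existsP=> u /andP[uO /existsP[v /andP[vW vu]]]; constructor 3.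
  have [y' [vy' same y'u]] := dropO u uO.
  exists u, y'; split=> //; constructor 2; split=> //; first exact: labO.
    by exists v => //; apply: labW.
  rewrite vy'; apply/(judgement_resolve _ _ uO vW vu) => //; exact: OA.
have far u v : u \in O -> v \in W -> ~~ adj v u.
  move=> uO vW; apply: contraNN nres => vu; apply/existsP; exists u; rewrite uO.
  by apply/existsP; exists v; rewrite vW.
have farA u : u \in slot j -> u \notin live j -> forall v, v \in rest j -> ~~ adj u v.
  move=> /slot_seen uj; rewrite inE uj /= => /hasPn no v; rewrite inE; exact: no.
have [|sWl] := boolP [exists u in W, u \notin live j].
  case/existsP=> u /andP[uW ul]; constructor 3.
  have gy : good_state (j, (W :\ u, O)).
    rewrite /good_state /= sO (subset_trans _ sW) ?subD1set //=.
    by apply: disjointWl dWO; apply: subD1set.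
  exists u, (exist (fun x => good_state x) _ gy); split.
    by move=> v /eqP vu; rewrite /dp_label /= !inE vu.
  constructor 3; split; first by left; apply: labW.
    by rewrite /dp_label /= in_setD1 eqxx (negPf (WA u uW)) (disjointFr dWO uW).
  apply: judgement_dropW J => v; rewrite inE => /orP[|vO]; last exact: far.
  by apply: farA => //; apply: (subsetP sW).
have [|sOl] := boolP [exists u in O, u \notin live j].
  case/existsP=> u /andP[uO ul]; constructor 3.
  have [y' [vy' same y'u]] := dropO u uO.
  exists u, y'; split=> //; constructor 3; split=> //; first by right; apply: labO.
  rewrite vy'; apply: judgement_dropO J; first exact: OA.
  move=> v; rewrite inE => /orP[vA|vW]; last exact: far.
  by rewrite adj_sym; apply: farA vA => //; apply: (subsetP sO).
have {sWl} sWl : W \subset live j.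
  by apply/subsetP=> u uW; apply: contraNT sWl => ul; apply/existsP; exists u; rewrite uW.
have {sOl} sOl : O \subset live j.
  by apply/subsetP=> u uO; apply: contraNT sOl => ul; apply/existsP; exists u; rewrite uO.
case: (ltnP j (size s)) => [lt_j|ge_j]; last first.
  have rest0 : rest j = set0 by apply/setP=> x; rewrite !inE drop_oversize.
  have live0 : live j = set0.
    by apply/setP=> x; rewrite !inE (drop_oversize ge_j) andbF.
  move: sWl sOl; rewrite live0 !subset0 => /eqP W0 /eqP O0.
  constructor 2; split; last first.
    by move=> u; rewrite /dp_label /= rest0 W0 O0 !inE.
  (* For i = 0 the judgement at the empty set would force m = 0. *)
  rewrite lt0n; apply/eqP=> i0; move/negP: m0; apply; rewrite -leqn0.
  apply: leq_trans (J set0 _ _) _; rewrite ?sub0set ?cards0 ?i0 //.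
  rewrite leqn0 cards_eq0; apply/eqP/setP=> x.
  by rewrite /touched rest0 O0 !inE.
have lt_jS : j.+1 < (size s).+1 by [].
case E: (drop j s) => [|u l].
  by move: lt_j; rewrite -subn_gt0 -size_drop E.
have dropS : drop j.+1 s = l.
  by rewrite -[l]/(behead (u :: l)) -E -drop1 drop_drop add1n.
have ul : u \notin l.
  by have := drop_uniq j uniq_s; rewrite E => /andP[].
have uA : u \in rest j by rewrite inE E mem_head.
have restS : rest j.+1 = rest j :\ u.
  apply/setP=> x; rewrite !inE dropS E inE; case: eqP => //= ->; exact/negbTE.
have slotS : slot j.+1 = u |: live j.
  by apply/setP=> x; rewrite /slot E /= take0 !inE orbC.
have uW : u \notin W by apply: contraL uA => /WA.
have uO : u \notin O by apply: contraL uA => /OA.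
pose j' : 'I_(size s).+1 := Ordinal lt_jS.
have gy : good_state (j', (W, u |: O)).
  rewrite /good_state slotS /= !subUset sub1set setU11 (subset_trans sWl) ?subsetUr //=.
  rewrite (subset_trans sOl) ?subsetUr //= disjoint_sym.
  by rewrite disjoints_subset subUset sub1set inE uW -disjoints_subset disjoint_sym.
constructor 3; exists u, (exist (fun x => good_state x) _ gy); split.
  by move=> v /eqP vu; rewrite /dp_label /= restS !inE (negPf vu).
constructor 1; split.
- by rewrite /dp_label /= uA.
- by rewrite /dp_label /= restS !inE eqxx /= (negPf uW).
- by rewrite /= restS; apply: judgement_branch_out.
move=> i0.
have gz : good_state (j', (u |: W, O)).
  rewrite /good_state slotS /= !subUset sub1set setU11 (subset_trans sWl) ?subsetUr //=.
  rewrite (subset_trans sOl) ?subsetUr //=.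
  by rewrite disjoints_subset subUset sub1set inE uO -disjoints_subset.
exists (exist (fun x => good_state x) _ gz); split.
- by move=> v /eqP vu; rewrite /dp_label /= restS !inE (negPf vu).
- by rewrite /dp_label /= restS !inE eqxx /= (negPf uO).
by rewrite /= restS; apply: judgement_branch_in.
Qed.

End Completeness.

Lemma derivation_complete (G : sgraph) (s : seq G) k : uniq s -> narrow k s ->
  exists (S : finType) (lab : S -> G -> label) (claim : S -> nat -> nat -> Prop) (x : S),
  [/\ #|S| <= (size s).+1 * 4 ^ k.+1,
      forall x i m, claim x i m -> justified lab claim x i m,
      forall u, lab x u = (u \in s, u \in s)
    & forall i m, judgement [set x in s] set0 set0 i m -> claim x i m].
Proof.
move=> us ns; have g0 : good_state (s := s) (ord0, (set0, set0)).
  by rewrite /good_state /= sub0set disjoints_subset sub0set.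
exists {: dp_state s}, (@dp_label G s), (@dp_claim G s),
  (exist (fun x => good_state x) _ g0); split.
- exact: card_dp_state ns.
- exact: dp_justified us.
- by move=> u; rewrite /dp_label /= drop0 !inE !orbF.
- by move=> i m; rewrite /dp_claim /= drop0.
Qed.

(** * The verifier as a first-order sentence *)

Inductive rform :=
  | RBit of bool & term
  | RLt of term & term
  | REq of term & term
  | RNot of rform
  | RAnd of rform & rform
  | ROr of rform & rform
  | RImp of rform & rform
  | REx of nat & rform
  | RAll of nat & rform.

Fixpoint rsat (y w : seq bool) (v : nat -> nat) (F : rform) : Prop :=
  match F with
  | RBit z t => nth false (if z then w else y) (tval v t)
  | RLt t u => tval v t < tval v u
  | REq t u => tval v t = tval v u
  | RNot F => ~ rsat y w v F
  | RAnd F G => rsat y w v F /\ rsat y w v G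
  | ROr F G => rsat y w v F \/ rsat y w v G
  | RImp F G => rsat y w v F -> rsat y w v G
  | REx x F => exists2 n, n <= size y + size w & rsat y w (upd v x n) F
  | RAll x F => forall n, n <= size y + size w -> rsat y w (upd v x n) F
  end.

Fixpoint reduce (F : rform) : form :=
  match F with
  | RBit z t => FBit z t
  | RLt t u => FLt t u
  | REq t u => FAnd (FNot (FLt t u)) (FNot (FLt u t))
  | RNot F => FNot (reduce F)
  | RAnd F G => FAnd (reduce F) (reduce G)
  | ROr F G => FNot (FAnd (FNot (reduce F)) (FNot (reduce G)))
  | RImp F G => FNot (FAnd (reduce F) (FNot (reduce G)))
  | REx x F => FEx x (reduce F)
  | RAll x F => FNot (FEx x (FNot (reduce F)))
  end.

Lemma sat_reduce y w F : forall v, sat y w v (reduce F) <-> rsat y w v F.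
Proof.
elim: F => [z t|t u|t u|F IHF|F IHF G IHG|F IHF G IHG|F IHF G IHG|x F IHF|x F IHF] v //=.
- by split=> [[]|->]; lia.
- by have := IHF v; tauto.
- by have := IHF v; have := IHG v; tauto.
- by have := IHF v; have := IHG v; have := EM (rsat y w v F);
  have := EM (rsat y w v G); tauto.
- by have := IHF v; have := IHG v; have := EM (rsat y w v G); tauto.
- by split=> -[n le_n Fn]; exists n => //; apply/IHF.
- split=> [noex n le_n|all [n le_n]]; last by apply; apply/IHF/all.
  by apply: contrapT => nF; apply: noex; exists n => // /IHF.
Qed.

Section Check.

Variables (y w : seq bool).
Let L := size y + size w.
Let Y p : Prop := nth false y p.

(* The witness encodes four relations, selected by k < 4, on triples with
   b, c <= n. *)
Definition entry_pos (n k a b c : nat) : nat := ((a * n.+1 + b) * n.+1 + c) * 4 + k.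
Let R n k a b c : Prop := nth false w (entry_pos n k a b c).

Section Fields.
Variable n : nat.

Definition ck_A s u : Prop := R n 0 s u 0 /\ R n 0 s u 1.
Definition ck_W s u : Prop := R n 0 s u 0 /\ ~ R n 0 s u 1.
Definition ck_O s u : Prop := ~ R n 0 s u 0 /\ R n 0 s u 1.
Definition ck_N s u : Prop := ~ R n 0 s u 0 /\ ~ R n 0 s u 1.
Definition ck_claim s i m : Prop := R n 1 s i m.
Definition ck_inj t u : Prop := R n 2 0 t u.
Definition ck_horner k t : Prop := R n 3 k t 0.
Definition ck_edge v u : Prop := Y (n.+1 + (v * n + u)).
Definition ck_bit k : Prop := Y (n.+1 + (n * n + k)).

Definition ck_size : Prop := ~ Y n /\ forall j, j <= L -> j < n -> Y j.

(** Decodes the binary numeral by Horner's scheme: [ck_horner k t] says that the bits from k on have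
    value t. Values up to n are enough, because a refutable m is at most |A|. *)
Definition ck_num m0 K : Prop :=
  m0 < n.+1 /\ ck_horner 0 m0 /\
  (forall k, k <= L -> k < K -> forall t, t <= L -> t < n.+1 -> ck_horner k t ->
   exists2 t', t' <= L & t' < n.+1 /\ ck_horner k.+1 t' /\
     (ck_bit k /\ t = (t' + t').+1 \/ ~ ck_bit k /\ t = t' + t')) /\
  (forall t, t <= L -> t < n.+1 -> ck_horner K t -> t = 0) /\
  (forall k, k <= L -> K < k.+1 -> ~ ck_bit k).

(** The inequality i0 <= |A| is witnessed by an injection of the numbers below i0 into A. The last
    conjunct makes W and O empty on the first line. *)
Definition ck_root s0 i0 : Prop :=
  0 < i0 /\ i0 < n.+1 /\
  (forall t, t <= L -> t < i0 ->
   exists2 u, u <= L & u < n /\ ck_inj t u /\ ck_A s0 u) /\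
  (forall t, t <= L -> forall t', t' <= L -> forall u, u <= L ->
   t < i0 -> t' < i0 -> u < n -> ck_inj t u -> ck_inj t' u -> t = t') /\
  (forall u, u <= L -> u < n -> ck_A s0 u \/ ck_N s0 u).

Definition ck_same s s' u : Prop := forall v, v <= L -> v < n ->
  v = u \/ (R n 0 s v 0 <-> R n 0 s' v 0) /\ (R n 0 s v 1 <-> R n 0 s' v 1).

(** [justified], read off the tables. Terms have no subtraction, so a predecessor appears as a
    guessed i' with i = i' + 1. *)
Definition ck_just s i m : Prop :=
  m = 0 \/ (0 < i /\ (forall u, u <= L -> u < n -> ~ ck_A s u)) \/
  exists2 u, u <= L & u < n /\ exists2 s', s' <= L & ck_same s s' u /\
   ((ck_A s u /\ ck_O s' u /\ ck_claim s' i m /\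
     (i = 0 \/ exists2 s'', s'' <= L & ck_same s s'' u /\ ck_W s'' u /\
       exists2 i', i' <= L & i = i'.+1 /\ ck_claim s'' i' m)) \/
    (ck_O s u /\ ck_N s' u /\
     (exists2 v, v <= L & v < n /\ ck_W s v /\ ck_edge v u) /\
     exists2 m', m' <= L & m = m'.+1 /\ ck_claim s' i m') \/
    ((ck_W s u \/ ck_O s u) /\ ck_N s' u /\ ck_claim s' i m)).

End Fields.

Definition check : Prop :=
  exists2 n, n <= L & exists2 s0, s0 <= L & exists2 i0, i0 <= L &
  exists2 m0, m0 <= L & exists2 K, K <= L &
    ck_size n /\ ck_num n m0 K /\ ck_root n s0 i0 /\ ck_claim n s0 i0 m0 /\
    forall s, s <= L -> forall i, i <= L -> forall m, m <= L ->
      i < n.+1 -> m < n.+1 -> ck_claim n s i m -> ck_just n s i m.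

End Check.

(* [check_form] mirrors [check]: variables 0-4 are n, s0, i0, m0, K. *)
Section CheckForm.

Let n := TVar 0.
Fixpoint num (k : nat) : term := if k is k'.+1 then TSucc (num k') else TZero.
Let R k a b c := RBit true (TAdd (TMul (TAdd (TMul (TAdd (TMul a (TSucc n)) b)
  (TSucc n)) c) (num 4)) (num k)).
Let Y p := RBit false p.
Let fA s u := RAnd (R 0 s u (num 0)) (R 0 s u (num 1)).
Let fW s u := RAnd (R 0 s u (num 0)) (RNot (R 0 s u (num 1))).
Let fO s u := RAnd (RNot (R 0 s u (num 0))) (R 0 s u (num 1)).
Let fN s u := RAnd (RNot (R 0 s u (num 0))) (RNot (R 0 s u (num 1))).
Let fclaim s i m := R 1 s i m.
Let finj t u := R 2 (num 0) t u.
Let fhorner k t := R 3 k t (num 0).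
Let fedge v u := Y (TAdd (TSucc n) (TAdd (TMul v n) u)).
Let fbit k := Y (TAdd (TSucc n) (TAdd (TMul n n) k)).

Let fsize := RAnd (RNot (Y n)) (RAll 5 (RImp (RLt (TVar 5) n) (Y (TVar 5)))).

Let fnum m0 K :=
  let k := TVar 5 in let t := TVar 6 in let t' := TVar 7 in
  RAnd (RLt m0 (TSucc n)) (RAnd (fhorner (num 0) m0)
  (RAnd (RAll 5 (RImp (RLt k K) (RAll 6 (RImp (RLt t (TSucc n)) (RImp (fhorner k t)
    (REx 7 (RAnd (RLt t' (TSucc n)) (RAnd (fhorner (TSucc k) t')
      (ROr (RAnd (fbit k) (REq t (TSucc (TAdd t' t'))))
           (RAnd (RNot (fbit k)) (REq t (TAdd t' t'))))))))))))
  (RAnd (RAll 6 (RImp (RLt t (TSucc n)) (RImp (fhorner K t) (REq t (num 0)))))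
        (RAll 5 (RImp (RLt K (TSucc k)) (RNot (fbit k))))))).

Let froot s0 i0 :=
  let t := TVar 5 in let t' := TVar 6 in let u := TVar 7 in
  RAnd (RLt (num 0) i0) (RAnd (RLt i0 (TSucc n))
  (RAnd (RAll 5 (RImp (RLt t i0) (REx 7 (RAnd (RLt u n) (RAnd (finj t u) (fA s0 u))))))
  (RAnd (RAll 5 (RAll 6 (RAll 7 (RImp (RLt t i0) (RImp (RLt t' i0) (RImp (RLt u n)
          (RImp (finj t u) (RImp (finj t' u) (REq t t')))))))))
        (RAll 7 (RImp (RLt u n) (ROr (fA s0 u) (fN s0 u))))))).

Let fiff F G := RAnd (RImp F G) (RImp G F).
Let fsame s s' u := let v := TVar 11 in RAll 11 (RImp (RLt v n)
  (ROr (REq v u) (RAnd (fiff (R 0 s v (num 0)) (R 0 s' v (num 0)))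
                       (fiff (R 0 s v (num 1)) (R 0 s' v (num 1)))))).

Let fjust s i m :=
  let u := TVar 8 in let s' := TVar 9 in let s'' := TVar 10 in let v := TVar 11 in
  let d := TVar 12 in
  ROr (REq m (num 0)) (ROr (RAnd (RLt (num 0) i) (RAll 8 (RImp (RLt u n) (RNot (fA s u)))))
  (REx 8 (RAnd (RLt u n) (REx 9 (RAnd (fsame s s' u)
    (ROr (RAnd (fA s u) (RAnd (fO s' u) (RAnd (fclaim s' i m)
      (ROr (REq i (num 0)) (REx 10 (RAnd (fsame s s'' u) (RAnd (fW s'' u)
        (REx 12 (RAnd (REq i (TSucc d)) (fclaim s'' d m))))))))))
    (ROr (RAnd (fO s u) (RAnd (fN s' u)
      (RAnd (REx 11 (RAnd (RLt v n) (RAnd (fW s v) (fedge v u))))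
        (REx 12 (RAnd (REq m (TSucc d)) (fclaim s' i d))))))
      (RAnd (ROr (fW s u) (fO s u)) (RAnd (fN s' u) (fclaim s' i m)))))))))).

Definition check_form : rform :=
  let s0 := TVar 1 in let i0 := TVar 2 in let m0 := TVar 3 in let K := TVar 4 in
  let s := TVar 5 in let i := TVar 6 in let m := TVar 7 in
  REx 0 (REx 1 (REx 2 (REx 3 (REx 4
    (RAnd fsize (RAnd (fnum m0 K) (RAnd (froot s0 i0) (RAnd (fclaim s0 i0 m0)
    (RAll 5 (RAll 6 (RAll 7 (RImp (RLt i (TSucc n)) (RImp (RLt m (TSucc n))
      (RImp (fclaim s i m) (fjust s i m))))))))))))))).

End CheckForm.

(** True by conversion, which is why [check] has its bounded quantifiers and nested conjunctions in
    exactly the shape that [rsat] produces. *)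
Lemma rsat_check y w v : rsat y w v check_form = check y w.
Proof. by []. Qed.

Lemma holds_on_check y w : holds_on (reduce check_form) y w <-> check y w.
Proof. by rewrite -(rsat_check y w (fun=> size y + size w)) -sat_reduce; split=> /asboolP. Qed.

(** * Soundness and completeness of the verifier *)

Lemma touched_root (G : sgraph) (A X : {set G}) :
  touched A set0 set0 X = [set u in A :\: X | [exists v in X, adj v u]].
Proof. by rewrite /touched setU0 set0U. Qed.

Lemma card_subset_ex (T : finType) (A : {set T}) i : i <= #|A| ->
  exists2 X : {set T}, X \subset A & #|X| = i.
Proof.
move=> le_i; exists [set x in take i (enum A)].
  by apply/subsetP=> x; rewrite inE => /mem_take; rewrite mem_enum.
rewrite cardsE (card_uniqP _) ?take_uniq ?enum_uniq //.
by rewrite size_takel // -cardE.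
Qed.

(** The m neighbours of an i-subset X lie in A outside X. This recovers the conjecture's bound on i
    from i <= |A|. *)
Lemma judgement_card (G : sgraph) (A : {set G}) i m :
  i <= #|A| -> judgement A set0 set0 i m -> i + m <= #|A|.
Proof.
move=> /card_subset_ex[X sX cX] /(_ X sX cX) le_m.
have := cardsID X A; rewrite (setIidPr sX) cX => <-; rewrite leq_add2l.
apply: leq_trans le_m _; apply/subset_leq_card/subsetP=> u.
by rewrite touched_root inE => /andP[].
Qed.

(** Adding all edges of G inside the vertex set only adds neighbours, so the subgraph of the
    conjecture may be taken induced and a vertex set suffices as witness. *)
Lemma ffn_gtP (G : sgraph) m : expansion_conjecture -> 0 < m ->
  m < ffn G <-> exists (A : {set G}) (i : nat),
    [/\ 0 < i, i <= #|A| & judgement A set0 set0 i m].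
Proof.
move=> conj m0; rewrite conj //; split=> [[H [i [i0 le_i nb]]]|[A [i [i0 le_i J]]]].
  exists (sub_vertices H), i; split=> // [|X sX cX]; first by lia.
  apply: leq_trans (nb X sX cX) _; apply/subset_leq_card/subsetP=> u.
  rewrite touched_root !inE => /andP[-> /existsP[v /andP[vX vu]]].
  case/and3P: (sub_adjP vu) => vu' _ -> /=.
  by apply/existsP; exists v; rewrite vX.
pose e := [rel x y : G | [&& adj x y, x \in A & y \in A]].
have sym_e : symmetric e by move=> x y /=; rewrite adj_sym [(x \in A) && _]andbC.
exists (@Subgraph G A e sym_e (fun _ _ h => h)), i.
have := judgement_card le_i J => le_im; split=> //=; first by lia.
move=> X sX cX; apply: leq_trans (J X sX cX) _; apply/subset_leq_card/subsetP=> u.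
rewrite touched_root !inE => /andP[/andP[-> uA] /existsP[v /andP[vX vu]]].
by apply/existsP; exists v; rewrite vX /e /= vu uA (subsetP sX).
Qed.

(** * Reading an instance off its encoding *)

Definition bin_value (s : seq bool) : nat := foldr (fun (b : bool) a => b + a.*2) 0 s.

Lemma bin_value_bits n : bin_value (bits_of_nat n) = n.
Proof.
rewrite -[RHS]bin_of_natK /bits_of_nat; case: (bin_of_nat n) => //= p.
by elim: p => //= p ->; rewrite NatTrec.doubleE.
Qed.

Lemma bin_value_drop s k :
  bin_value (drop k s) = nth false s k + (bin_value (drop k.+1 s)).*2.
Proof.
case: (ltnP k (size s)) => [lt_k|le_k]; first by rewrite (drop_nth false lt_k).
by rewrite !drop_oversize ?nth_default // (leq_trans le_k).
Qed.

Lemma bin_value0 s : (forall k, ~~ nth false s k) -> bin_value s = 0.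
Proof.
elim: s => //= b s IHs no; rewrite IHs => [|k]; last exact: (no k.+1).
by have := no 0; case: (b).
Qed.

Lemma nth_allpairs (S T R : Type) (f : S -> T -> R) x0 y0 z0 s t i j :
  i < size s -> j < size t ->
  nth z0 [seq f x y | x <- s, y <- t] (i * size t + j) = f (nth x0 s i) (nth y0 t j).
Proof.
move=> + lt_j; elim: s i => //= x s IHs [|i] lt_i; rewrite nth_cat size_map.
  by rewrite lt_j (nth_map y0).
rewrite mulSn -addnA ltnNge leq_addr /= addKn; exact: IHs.
Qed.

Section Encoding.

Variable I : ff_instance.
Let G := ff_graph I.
Let n := #|G|.
Let y := ff_encode I.

Lemma ff_encode_size : size y = n.+1 + (n * n + size (bits_of_nat (ff_num I))).
Proof.
rewrite /y /ff_encode size_cat size_nseq /= size_cat size_allpairs -!cardE.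
by rewrite addnS.
Qed.

Lemma ff_encode_lt j : j < n -> nth false y j.
Proof. by move=> lt_j; rewrite /y /ff_encode nth_cat size_nseq lt_j nth_nseq lt_j. Qed.

Lemma ff_encode_n : ~~ nth false y n.
Proof. by rewrite /y /ff_encode nth_cat size_nseq ltnn subnn. Qed.

Lemma nth_encode_tail j : nth false y (n.+1 + j) =
  nth false ([seq adj u v | u <- enum G, v <- enum G] ++ bits_of_nat (ff_num I)) j.
Proof.
rewrite /y /ff_encode nth_cat size_nseq -/n ltnNge (leq_trans _ (leq_addr _ _)) //=.
by rewrite addSn subSn ?leq_addr // addKn.
Qed.

Lemma ff_encode_edge x0 u v : u < n -> v < n ->
  nth false y (n.+1 + (u * n + v)) = adj (nth x0 (enum G) u) (nth x0 (enum G) v).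
Proof.
move=> lt_u lt_v; rewrite nth_encode_tail nth_cat size_allpairs -!cardE -/n.
have -> : u * n + v < n * n.
  by apply: (@leq_trans (u.+1 * n)); [rewrite mulSn addnC ltn_add2r | rewrite leq_mul2r lt_u orbT].
by have := @nth_allpairs _ _ _ (@adj G) x0 x0 false (enum G) (enum G) u v;
  rewrite -!cardE; apply.
Qed.

Lemma ff_encode_bit k :
  nth false y (n.+1 + (n * n + k)) = nth false (bits_of_nat (ff_num I)) k.
Proof.
rewrite nth_encode_tail nth_cat size_allpairs -!cardE -/n ltnNge leq_addr /=.
by rewrite addKn.
Qed.

Lemma ck_size_encode w k : ck_size y w k -> k = n.
Proof.
move=> [nk all]; apply/eqP; rewrite eqn_leq; apply/andP; split; rewrite leqNgt; apply/negP.
  move=> lt_nk; have := ff_encode_n; rewrite all //.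
  by rewrite ff_encode_size; lia.
by move/ff_encode_lt.
Qed.

Lemma ck_num_encode w m0 K : K <= size y + size w -> ck_num y w n m0 K -> m0 = ff_num I.
Proof.
move=> le_K [le_m0 [h0 [step [last zero]]]].
have le_n : n <= size y by rewrite ff_encode_size; lia.
rewrite -(bin_value_bits (ff_num I)); set s := bits_of_nat _.
(* Descending induction on k, starting at K, where the value is 0. *)
suff val d k t : k + d = K -> t < n.+1 -> ck_horner w n k t -> t = bin_value (drop k s).
  by rewrite -[s]drop0; apply: (val K) h0.
elim: d k t => [|d IHd] k t.
  rewrite addn0 => -> lt_t hK; rewrite (last t _ lt_t hK); last by lia.
  apply/esym/bin_value0 => j; rewrite nth_drop -ff_encode_bit; apply/negP.
  (* The quantifier over bits stops at L; what it does not reach lies beyond the word and reads as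
     false. *)
  case: (leqP (n.+1 + (n * n + (K + j))) (size y + size w)) => [le|lt].
    by apply: zero; lia.
  by rewrite nth_default //; lia.
move=> kd lt_t hk; have lt_kK : k < K by lia.
have [||t' _ [lt_t' [hk' tE]]] := step k _ lt_kK t _ lt_t hk; [lia | lia | ].
have {hk' IHd} E' := IHd k.+1 t' _ lt_t' hk'.
rewrite bin_value_drop -E'; last by lia.
rewrite -ff_encode_bit -/y -/n; case: tE => -[].
  by rewrite /ck_bit => -> ->; lia.
by rewrite /ck_bit => /negP/negPf-> ->; lia.
Qed.

Theorem check_sound w : expansion_conjecture -> check y w -> ff_num I < ffn G.
Proof.
move=> conj [k _ [s0 le_s0 [i0 le_i0 [m0 le_m0 [K le_K]]]]].
move=> [/ck_size_encode-> [ck_m0 [root [c0 just]]]].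
have m0E := ck_num_encode le_K ck_m0; have [lt_m0 _] := ck_m0.
have [i0_gt0 [lt_i0 [inj_ex [inj_inj lab0]]]] := root.
set L := size y + size w in le_s0 inj_ex inj_inj lab0 just *.
have le_nL : n <= L by rewrite /L ff_encode_size; lia.
have [x0 _] : exists x0, x0 \in G by apply/card_gt0P; rewrite -/n; lia.
pose lab (s : nat) (u : G) : label :=
  (nth false w (entry_pos n 0 s (enum_rank u) 0),
   nth false w (entry_pos n 0 s (enum_rank u) 1)).
(* Rows are restricted to the range of the quantifiers, since only there does the check guarantee a
   justification. *)
pose claim s i m := s <= L /\ ck_claim w n s i m.
have rk (u : G) : enum_rank u < n by [].
have vtx u : u < n -> exists2 x : G, u = enum_rank x & nth x0 (enum G) u = x.
  by move=> lt_u; exists (enum_val (Ordinal lt_u)); rewrite ?enum_valK // (enum_val_nth x0).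
have labA s x : ck_A w n s (enum_rank x) <-> lab s x = LA.
  by rewrite /ck_A /lab /LA; split=> [[-> ->]|[-> ->]].
have labW s x : ck_W w n s (enum_rank x) <-> lab s x = LW.
  by rewrite /ck_W /lab /LW; split=> [[-> /negP/negPf->]|[-> ->]].
have labO s x : ck_O w n s (enum_rank x) <-> lab s x = LO.
  by rewrite /ck_O /lab /LO; split=> [[/negP/negPf-> ->]|[-> ->]].
have labN s x : ck_N w n s (enum_rank x) <-> lab s x = LN.
  by rewrite /ck_N /lab /LN; split=> [[/negP/negPf-> /negP/negPf->]|[-> ->]].
have same s s' x : ck_same y w n s s' (enum_rank x) -> same_off lab s s' x.
  move=> sm v vx; have [||/val_inj/enum_rank_inj//|[E0 E1]] := sm (enum_rank v).
  - exact: leq_trans (ltnW (rk v)) le_nL.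
  - exact: rk.
  by rewrite /lab; congr pair; apply/idP/idP; [move/E0|move/E0|move/E1|move/E1].
have J : lab_judgement lab s0 i0 m0.
  apply: (@derivation_sound G nat lab claim n) => //.
  move=> s i m le_i le_m [le_s cl].
  have := just s le_s i _ m _ le_i le_m cl.
  case=> [||->|[[i_gt0 noA]|]]; [lia | lia | by constructor 1 | |].
    constructor 2; split=> // x /labA; apply: noA; last exact: rk.
    exact: leq_trans (ltnW (rk x)) le_nL.
  move=> [u' _ [lt_u' [s' le_s' [sm cases]]]].
  have [u uE _] := vtx u' lt_u'; rewrite {}uE {u' lt_u'} in sm cases.
  constructor 3; exists u, s'; split; first exact: same.
  case: cases => [[/labA lA [/labO lO [cl' next]]]|[|]].
  - constructor 1; split=> // i_gt0; case: next => [i0'|]; first by rewrite i0' in i_gt0.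
    move=> [s'' le_s'' [/same sm'' [/labW lW [i' _ [-> cl'']]]]].
    by exists s''.
  - move=> [/labO lO [/labN lN [[v' _ [lt_v' [vW vu]]] [m' _ [-> cl']]]]].
    have [v vE vE'] := vtx v' lt_v'; constructor 2; split=> //.
    exists v; first by apply/labW; rewrite -vE.
    move: vu; rewrite /ck_edge (ff_encode_edge x0) // vE'.
    by rewrite nth_enum_rank.
  - move=> [lWO [/labN lN cl']]; constructor 3; split=> //.
    by case: lWO => [/labW|/labO]; [left | right].
apply/ffn_gtP => //; first exact: ff_num_gt0.
exists (lab_set lab LA s0), i0; split=> //.
  have /choice[f fP] (t : 'I_i0) : exists u : G,
      ck_inj w n t (enum_rank u) /\ lab s0 u = LA.
    have [|u' _ [lt_u' [tu uA]]] := inj_ex t _ (ltn_ord t).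
      by have := ltn_ord t; lia.
    have [u uE _] := vtx u' lt_u'; exists u; rewrite -uE; split=> //.
    by apply/labA; rewrite -uE.
  have f_inj : injective f.
    move=> t t' ff; have [tf _] := fP t; have [tf' _] := fP t'.
    have lt_t := ltn_ord t; have lt_t' := ltn_ord t'; have lt_u := rk (f t).
    rewrite -ff in tf'; apply: val_inj.
    by apply: inj_inj tf tf' => //; rewrite /L; lia.
  rewrite -[i0]card_ord -(card_imset _ f_inj).
  apply/subset_leq_card/subsetP=> _ /imsetP[t _ ->].
  by rewrite inE; have [_ ->] := fP t.
rewrite -m0E; move: J; rewrite /lab_judgement.
have lab0' x : lab s0 x = LA \/ lab s0 x = LN.
  have [|||] := lab0 (enum_rank x); [|exact: rk|by move/labA; left|by move/labN; right].
  exact: leq_trans (ltnW (rk x)) le_nL.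
have -> : lab_set lab LW s0 = set0.
  by apply/setP=> x; rewrite !inE; case: (lab0' x) => ->.
have -> // : lab_set lab LO s0 = set0.
by apply/setP=> x; rewrite !inE; case: (lab0' x) => ->.
Qed.

End Encoding.

(** * Writing the certificate *)

Definition table_word (n rows : nat) (T : nat -> nat -> nat -> nat -> bool) : seq bool :=
  mkseq (fun p => T (p %% 4) (p %/ 4 %/ n.+1 %/ n.+1) (p %/ 4 %/ n.+1 %% n.+1)
                    (p %/ 4 %% n.+1))
        (rows * n.+1 * n.+1 * 4).

Lemma nth_table_word n rows T k a b c : k < 4 -> b <= n -> c <= n ->
  nth false (table_word n rows T) (entry_pos n k a b c) = (a < rows) && T k a b c.
Proof.
rewrite -[b <= n]ltnS -[c <= n]ltnS => lt_k lt_b lt_c; rewrite /entry_pos.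
have lt_pos : (((a * n.+1 + b) * n.+1 + c) * 4 + k < rows * n.+1 * n.+1 * 4) = (a < rows).
  by do 3!rewrite -ltn_divLR // divnMDl // (divn_small (_ : _ < _)) // addn0.
case: (ltnP a rows) => [lt_a|le_a]; last first.
  by rewrite nth_default // size_mkseq leqNgt lt_pos -leqNgt.
rewrite nth_mkseq ?lt_pos //=.
rewrite modnMDl (modn_small lt_k) divnMDl // (divn_small lt_k) addn0.
rewrite modnMDl (modn_small lt_c) divnMDl // (divn_small lt_c) addn0.
by rewrite modnMDl (modn_small lt_b) divnMDl // (divn_small lt_b) addn0.
Qed.

(** With 2^k <= 2|A| the factor 4^((c+1)k) is at most (2N)^(2(c+1)), which bounds the number of
    states; N more rows make room for the bits of the numeral. Each row has 4(n+1)^2 entries. *)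
Definition cert_bound (c N : nat) : nat :=
  (N.+1 * (4 * (2 * N) ^ (2 * c.+1)) + N).+1 * N.+1 * N.+1 * 4.

Theorem check_complete (I : ff_instance) c : expansion_conjecture ->
  treewidth (ff_graph I) <= c -> ff_num I < ffn (ff_graph I) ->
  exists2 w, size w <= cert_bound c (size (ff_encode I)) & check (ff_encode I) w.
Proof.
move=> conj tw /(ffn_gtP _ conj (ff_num_gt0 I))[A [i0 [i0_gt0 le_i0 J]]].
set y := ff_encode I; set G := ff_graph I in tw A le_i0 J *; set m0 := ff_num I in J *.
pose n := #|G|; have yE := ff_encode_size I; rewrite -/y -/n in yE.
set bits := bits_of_nat _ in yE.
have le_A : #|A| <= n by apply: max_card.
have le_im := judgement_card le_i0 J.
have [v0 _] : exists v0, v0 \in A by apply/card_gt0P; lia.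
(* The least k with |A| < 2^k, so that 2^k <= 2|A| holds as well. *)
pose k := (trunc_log 2 #|A|).+1.
have [|s [us sA] ns] := treewidth_narrow_order tw (k := k) (U := A).
  exact: trunc_log_ltn.
have sE : [set x in s] = A by apply/setP=> x; rewrite inE sA.
have szs : size s = #|A| by rewrite -(card_uniqP us); apply: eq_card.
have [S [lab [claim [x0 [cS just lab0 claim0]]]]] := derivation_complete us ns.
have {claim0} claim0 : claim x0 i0 m0 by apply: claim0; rewrite sE.
(* Labels and claims use one row per state; the Horner table uses one row per suffix of the numeral,
   the empty one included. *)
pose rows := (#|S| + size bits).+1.
pose st q := nth x0 (enum S) q; pose vt u := nth v0 (enum G) u.
have stK (x : S) : st (enum_rank x) = x by apply: nth_enum_rank.
have vtK (u : G) : vt (enum_rank u) = u by apply: nth_enum_rank.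
pose T j a b d := match j with
  | 0 => if d == 0 then (lab (st a) (vt b)).1 else (lab (st a) (vt b)).2
  | 1 => (a < #|S|) && `[< claim (st a) b d >]
  | 2 => nth v0 (enum A) b == vt d
  | _ => b == bin_value (drop a bits) end.
pose w := table_word n rows T.
have wE j a b d : j < 4 -> b <= n -> d <= n ->
    nth false w (entry_pos n j a b d) = (a < rows) && T j a b d.
  exact: nth_table_word.
have szw : size w = rows * n.+1 * n.+1 * 4 by rewrite size_mkseq.
(* The certificate is at least as long as its number of rows, so quantifiers bounded by L reach
   every row. *)
have le_rows : rows <= size w by rewrite szw -!mulnA leq_pmulr.
exists w.
  have log_le : 2 ^ k <= 2 * #|A|.
    by rewrite expnS leq_pmul2l // trunc_logP //; lia.
  have pow_le : 4 ^ (c.+1 * k).+1 <= 4 * (2 * size y) ^ (2 * c.+1).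
    rewrite expnS leq_pmul2l // -[4]/(2 ^ 2) -expnM mulnA [_ * k]mulnC expnM.
    by rewrite leq_exp2r //; apply: leq_trans log_le _; lia.
  have le_S : #|S| <= (size y).+1 * (4 * (2 * size y) ^ (2 * c.+1)).
    by apply: leq_trans cS _; apply: leq_mul => //; lia.
  rewrite szw /cert_bound leq_pmul2r // /rows.
  by do 2![apply: leq_mul; last by lia]; lia.
have n_gt0 : 0 < n by lia.
have rk (u : G) : enum_rank u < n by [].
have rkS (x : S) : enum_rank x < rows.
  by rewrite ltnS; apply: leq_trans (ltnW (ltn_ord _)) (leq_addr _ _).
have labE0 x (u : G) : nth false w (entry_pos n 0 (enum_rank x) (enum_rank u) 0) = (lab x u).1.
  by rewrite wE ?(ltnW (rk u)) // rkS /= stK vtK.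
have labE1 x (u : G) : nth false w (entry_pos n 0 (enum_rank x) (enum_rank u) 1) = (lab x u).2.
  by rewrite wE ?(ltnW (rk u)) // rkS /= stK vtK.
have ckA x u : lab x u = LA -> ck_A w n (enum_rank x) (enum_rank u).
  by move=> E; rewrite /ck_A labE0 labE1 E.
have ckW x u : lab x u = LW -> ck_W w n (enum_rank x) (enum_rank u).
  by move=> E; rewrite /ck_W labE0 labE1 E.
have ckO x u : lab x u = LO -> ck_O w n (enum_rank x) (enum_rank u).
  by move=> E; rewrite /ck_O labE0 labE1 E.
have ckN x u : lab x u = LN -> ck_N w n (enum_rank x) (enum_rank u).
  by move=> E; rewrite /ck_N labE0 labE1 E.
have vtx u : u < n -> exists2 v : G, u = enum_rank v & vt u = v.
  by move=> lt_u; exists (enum_val (Ordinal lt_u)); rewrite ?enum_valK // /vt (enum_val_nth v0).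
have same x x' u : same_off lab x x' u ->
    ck_same y w n (enum_rank x) (enum_rank x') (enum_rank u).
  move=> sm v' _ lt_v'; have [v -> _] := vtx v' lt_v'.
  have [->|/eqP nvu] := eqVneq v u; first by left.
  by right; rewrite !labE0 !labE1 sm.
have claimE x i m : i <= n -> m <= n -> claim x i m -> ck_claim w n (enum_rank x) i m.
  move=> le_i le_m cl; rewrite /ck_claim wE // rkS /= ltn_ord stK.
  exact/asboolP.
have leL q : q < rows -> q <= size y + size w by lia.
exists n; first by lia.
exists (enum_rank x0); first exact/leL/rkS.
exists i0; first by lia.
exists m0; first by lia.
exists (size bits); first by lia.
have nth_bit j : ck_bit y n j <-> nth false bits j.
  by rewrite /ck_bit ff_encode_bit.
split; first by split=> [|j _]; [apply/negP/ff_encode_n | apply: ff_encode_lt].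
split; [|split; [|split]].
- have hE j t : t <= n -> ck_horner w n j t <-> (j < rows) && (t == bin_value (drop j bits)).
    by move=> le_t; rewrite /ck_horner wE.
  split; first by lia.
  split; first by apply/hE; [lia | rewrite drop0 bin_value_bits /= /rows eqxx].
  split; last split.
  + move=> j _ lt_j t _ lt_t /hE-/(_ lt_t)/andP[_ /eqP tE].
    move: (tE); rewrite bin_value_drop; set t' := bin_value _ => tE'.
    have le_t' : t' <= n by lia.
    exists t'; first by lia.
    split=> //; split; first by apply/hE => //; rewrite eqxx andbT /rows; lia.
    case: (boolP (nth false bits j)) tE' => bj tE'; [left|right]; split.
    * exact/nth_bit.
    * by lia.
    * by move/nth_bit; apply/negP.
    * by lia.
  + move=> t _ lt_t /hE-/(_ lt_t)/andP[_ /eqP->].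
    by rewrite drop_size.
  + by move=> j _ le_j /nth_bit; rewrite nth_default.
- have injE t u : t <= n -> u <= n -> ck_inj w n t u <-> nth v0 (enum A) t = vt u.
    by move=> le_t le_u; rewrite /ck_inj wE //=; split=> /eqP.
  split=> //; split; first by lia.
  split; last split.
  + move=> t _ lt_t; pose u := nth v0 (enum A) t.
    have uA : u \in A by rewrite -mem_enum mem_nth // -cardE; lia.
    have lt_u := rk u; exists (enum_rank u); first by lia.
    split=> //; split; first by apply/injE; rewrite ?vtK //; lia.
    by apply: ckA; rewrite lab0 sA uA.
  + move=> t _ t' _ u _ lt_t lt_t' lt_u; rewrite !injE; try lia.
    move=> E E'; have [lt_tA lt_tA'] : t < size (enum A) /\ t' < size (enum A).
      by rewrite -cardE; lia.
    by apply/eqP; rewrite -(nth_uniq v0 lt_tA lt_tA' (enum_uniq A)) E E'.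
  + move=> u' _ lt_u'; have [u -> _] := vtx u' lt_u'.
    case: (boolP (u \in A)) => uA; [left; apply: ckA | right; apply: ckN];
      by rewrite lab0 sA ?uA ?(negPf uA).
- by apply: claimE => //; lia.
move=> q _ i _ m _ lt_i lt_m; rewrite /ck_claim wE // => /and3P[_ lt_q /asboolP cl].
have [x qE stq] : exists2 x : S, q = enum_rank x & st q = x.
  by exists (enum_val (Ordinal lt_q)); rewrite ?enum_valK // /st (enum_val_nth x0).
rewrite {}stq in cl; rewrite {}qE {q lt_q}.
case: (just x i m cl) => [->|[i_gt0 noA]|[u [x' [sm cases]]]]; first by left.
  right; left; split=> // u' _ lt_u'; have [u -> _] := vtx u' lt_u'.
  by rewrite /ck_A labE0 labE1; case E: (lab x u) (noA u) => [[] []] no [].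
have [->|m_gt0] := eqVneq m 0; first by left.
right; right; have lt_u := rk u; exists (enum_rank u); first by lia.
split=> //; exists (enum_rank x'); first exact/leL/rkS.
split; first exact: same.
case: cases => [[lA lO cl' next]|[lO lN [v lW vu] cl']|[lWO lN cl']].
- left; split; [exact: ckA | split; [exact: ckO | split; [exact: claimE|]]].
  have [->|i_gt0] := eqVneq i 0; first by left.
  rewrite -lt0n in i_gt0; have [x'' [sm'' lW cl'']] := next i_gt0.
  right; exists (enum_rank x''); first exact/leL/rkS.
  split; first exact: same.
  split; first exact: ckW.
  exists i.-1; first by lia.
  by split; [lia | apply: claimE => //; lia].
- right; left; split; [exact: ckO | split; [exact: ckN | split]].
    have lt_v := rk v; exists (enum_rank v); first by lia.
    split=> //; split; first exact: ckW.
    by rewrite /ck_edge (ff_encode_edge v0) // !nth_enum_rank.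
  exists m.-1; first by lia.
  by split; [lia | apply: claimE => //; lia].
right; right; split; last by split; [exact: ckN | exact: claimE].
by case: lWO => E; [left; apply: ckW | right; apply: ckO].
Qed.

(** A word outside L is certified by a derivation for its image. The reduction guarantees that the
    image codes a graph of treewidth at most c, so the verifier takes this for granted. *)
Lemma reducible_coNP (L : language) c : expansion_conjecture ->
  reduces_to L (@restrict FireFighting (fun I => treewidth (ff_graph I) <= c)) ->
  coNP L.
Proof.
move=> conj [f [pf fP]].
have [p size_f] := polytime_size pf.
have [q qE] : nat_poly (cert_bound c) by rewrite /cert_bound; nat_poly_tac.
exists (fun x w => holds_on (reduce check_form) (f x) w), (q \Po p)%R.
split; first exact: polytime_rel_form.
move=> x; have [[I tw] [fx Lx]] := fP x; rewrite /= in fx Lx.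
rewrite Lx fx; split=> [/negP|[w [_ /holds_on_check /(check_sound conj) lt_m]]].
  rewrite -ltnNge => /(check_complete conj tw)[w le_w cw]; exists w; split.
    apply: leq_trans le_w _; rewrite qE horner_comp -fx.
    exact/horner_nat_mono/size_f.
  exact/holds_on_check.
by apply/negP; rewrite -ltnNge.
Qed.

Theorem theorem7
  (NP_neq_coNP : ~ (forall L : language, NP L <-> coNP L))
  (conjecture : expansion_conjecture)
  (c : nat) :
  ~ NP_hard (@restrict FireFighting (fun I => treewidth (ff_graph I) <= c)).
Proof.
move=> hard; apply: NP_neq_coNP.
have NP_coNP L : NP L -> coNP L by move=> /hard; apply: reducible_coNP.
move=> L; split; first exact: NP_coNP.
(* For L in coNP, apply the inclusion to the complement of L: its complement is in NP and equals L
   by double negation. *)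
move=> /NP_coNP; rewrite /coNP; congr NP; apply: funext => x.
by apply: propext; split=> [/contrapT|Lx].
Qed.
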